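(* Let $N\ge 1$, let $Q,B$ be real $N\times N$ matrices with $Q=Q^\star\ge 0$ such that $K(t)$ is invertible for every $t>0$. Let $f\in\mathscr S$ and $X\in\mathbb R^N$. The following holds: (i) if $\max\{\Re(\lambda)\mid\lambda\in\sigma(B)\}\ge0$, then $$\lim_{s\to0^+}(-\mathscr A)^sf(X)=f(X);$$ (ii) if, on the other hand, $\max\{\Re(\lambda)\mid\lambda\in\sigma(B)\}<0$, then $$\lim_{s\to0^+}(-\mathscr A)^sf(X)=f(X)-\frac{(4\pi)^{-N/2}}{\sqrt{\det K_\infty}}\int_{\mathbb R^N}f(Y)\,e^{-\frac{\langle K_\infty^{-1}Y,Y\rangle}{4}}\,dY.$$
   Context: Here $Q,B$ are the constant coefficients of the operator $\mathscr A u=\operatorname{tr}(Q\nabla^2u)+\langle BX,\nabla u\rangle$ on $\mathbb R^N$, and $K(t)=\frac1t\int_0^t e^{sB}Qe^{sB^\star}\,ds$ for $t>0$ ($^\star$ denotes transpose). $\mathscr S$ is the Schwartz space on $\mathbb R^N$, $\sigma(B)$ the spectrum of $B$. For $X,Y\in\mathbb R^N$, $t>0$, $$p(X,Y,t)=\frac{(4\pi)^{-N/2}}{\sqrt{\det(tK(t))}}\exp\Big(-\frac{\langle K(t)^{-1}(Y-e^{tB}X),\,Y-e^{tB}X\rangle}{4t}\Big),\qquad P_tf(X)=\int_{\mathbb R^N}p(X,Y,t)f(Y)\,dY.$$ For $0<s<1$ and $f\in\mathscr S$ the fractional power is defined pointwise by the (convergent) integral $$(-\mathscr A)^sf(X)=-\frac{s}{\Gamma(1-s)}\int_0^\infty\frac{1}{t^{1+s}}\big(P_tf(X)-f(X)\big)\,dt.$$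 When all eigenvalues of $B$ have negative real part, $K_\infty=\int_0^\infty e^{sB}Qe^{sB^\star}\,ds$, which is a finite positive definite matrix. *)

(* Defs.v *)
From HB Require Import structures.
From mathcomp Require Import all_boot all_order all_algebra.
From mathcomp Require Import complex.
From mathcomp Require Import all_classical all_reals all_analysis.

Set Implicit Arguments.
Unset Strict Implicit.
Unset Printing Implicit Defensive.

Import Order.TTheory GRing.Theory Num.Theory.
Import numFieldNormedType.Exports.

Local Open Scope classical_set_scope.
Local Open Scope ring_scope.

Section lebesgue_Rn.
Variable R : realType.

Local Notation RT := (measurableTypeR R).

Definition tuple_cons n (p : RT * n.-tuple RT) : n.+1.-tuple RT :=
  [tuple of p.1 :: p.2].

Lemma measurable_tuple_cons n : measurable_fun setT (@tuple_cons n).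
Proof. exact: measurable_cons. Qed.

Definition lebesgue_cons n (m : {measure set (n.-tuple RT) -> \bar R}) :
    set (n.+1.-tuple RT) -> \bar R :=
  pushforward ((@lebesgue_measure R) \x^ m)%E (@tuple_cons n).

Section lebesgue_cons_measure.
Variables (n : nat) (m : {measure set (n.-tuple RT) -> \bar R}).

Let lebesgue_cons0 : lebesgue_cons m set0 = 0%E.
Proof. by rewrite /lebesgue_cons /pushforward preimage_set0 measure0. Qed.

Let lebesgue_cons_ge0 A : (0 <= lebesgue_cons m A)%E.
Proof. by rewrite /lebesgue_cons /pushforward measure_ge0. Qed.

Let lebesgue_cons_sigma_additive : semi_sigma_additive (lebesgue_cons m).
Proof.
have mc := @measurable_tuple_cons n.
exact: (@measure_semi_sigma_additive _ _ _
  (measure_function_pushforward__canonical__measure_function_Measure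
     ((@lebesgue_measure R) \x^ m)%E mc)).
Qed.

HB.instance Definition _ := isMeasure.Build _ _ _ (lebesgue_cons m)
  lebesgue_cons0 lebesgue_cons_ge0 lebesgue_cons_sigma_additive.

End lebesgue_cons_measure.

(* Lebesgue measure on R^n, as the n-fold product of the one-dimensional
   Lebesgue measure; for n = 0 it is the unit mass at the empty tuple. *)
Fixpoint lebesgue_tuple n : {measure set (n.-tuple RT) -> \bar R} :=
  match n with
  | 0 => dirac [tuple]
  | m.+1 => lebesgue_cons (lebesgue_tuple m)
  end.

Definition integralRn n (f : 'cV[R]_n -> R) : R :=
  \int[lebesgue_tuple n]_y f (\col_i tnth y i).

End lebesgue_Rn.

Section vectors_and_matrices.
Variables (R : realType) (N : nat).
Implicit Types (A B Q : 'M[R]_N) (u v : 'cV[R]_N).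

Definition inner u v : R := \sum_i u i 0 * v i 0.

Definition psd Q : Prop := forall v, 0 <= inner (Q *m v) v.

Definition expmx A : 'M[R]_N :=
  limn (series (fun k => (k`!%:R)^-1 *: A ^+ k)).

Definition integralmx (D : set R) (F : R -> 'M[R]_N) : 'M[R]_N :=
  \matrix_(i, j) \int[@lebesgue_measure R]_(s in D) F s i j.

Definition spectrum B : set R[i] :=
  [set l | eigenvalue (map_mx (real_complex R) B) l].

(* For N >= 1 the spectrum is finite and nonempty, so that this supremum is the
   maximum of Re over the spectrum. *)
Definition max_Re_spectrum B : R := sup [set complex.Re l | l in spectrum B].

End vectors_and_matrices.

Section schwartz.
Variables (R : realType) (N : nat).
Implicit Type f : 'cV[R]_N -> R.

Definition partial (i : 'I_N) f : 'cV[R]_N -> R :=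
  fun x => 'D_(delta_mx i 0) f x.

Definition partials (l : seq 'I_N) f := foldr partial f l.

(* The iterated partial derivatives are indexed by sequences of directions
   rather than by multi-indices. *)
Definition schwartz f : Prop :=
  (forall l x, differentiable (partials l f) x) /\
  (forall (a : 'I_N -> nat) l, exists C : R, forall x : 'cV[R]_N,
     `|(\prod_(i < N) x i 0 ^+ a i) * partials l f x| <= C).

End schwartz.

Definition Gamma (R : realType) (z : R) : R :=
  \int[@lebesgue_measure R]_(t in `]0, +oo[) (t `^ (z - 1) * expR (- t)).

Section semigroup.
Variables (R : realType) (N : nat) (Q B : 'M[R]_N).

Definition covariance (s : R) : 'M[R]_N :=
  expmx (s *: B) *m Q *m expmx (s *: B^T).

Definition Kmx (t : R) : 'M[R]_N := t^-1 *: integralmx `[0, t] covariance.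

Definition Kinfty : 'M[R]_N := integralmx `[0, +oo[ covariance.

Definition kernel_p (X Y : 'cV[R]_N) (t : R) : R :=
  let Z := Y - expmx (t *: B) *m X in
  (4 * pi) `^ (- (N%:R / 2)) / Num.sqrt (\det (t *: Kmx t)) *
  expR (- (inner (invmx (Kmx t) *m Z) Z / (4 * t))).

Definition Psg (t : R) (f : 'cV[R]_N -> R) (X : 'cV[R]_N) : R :=
  integralRn (fun Y => kernel_p X Y t * f Y).

(* Balakrishnan formula for (- A)^s, meaningful for 0 < s < 1, where A is the
   generator u |-> tr (Q D^2 u) + <B X, grad u> of the semigroup Psg. *)
Definition fracpow (s : R) (f : 'cV[R]_N -> R) (X : 'cV[R]_N) : R :=
  - (s / Gamma (1 - s)) *
  \int[@lebesgue_measure R]_(t in `]0, +oo[)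
    ((t `^ (1 + s))^-1 * (Psg t f X - f X)).

End semigroup.

(* Main.v *)
(** Put [M t = t K(t)] and let [L] be the limit of [P_t f(X)] as [t] goes to
    infinity.  Near [t = 0] one has [P_t f(X) - f(X) = O(sqrt t)], so the
    integral over ]0,1] contributes [O(s)]; on ]1,oo[ the measure
    [s t^(-1-s) dt] has mass 1 and escapes to infinity as [s] goes to 0.  As
    [Gamma(1 - s)] tends to 1, the limit of the fractional powers is
    [f(X) - L], and it remains to find [L].

    If [B] has an eigenvalue with nonnegative real part, the matrices [M t]
    dominate [M 1] and grow at least linearly in some direction.  Since
    [M = det(M) adj(M^-1)] with [M^-1 <= (M 1)^-1], the determinant of [M t]
    tends to infinity, and [L = 0] because [f] is integrable.

    If the spectrum lies in the open left half-plane, triangularising [B] over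
    the complex numbers and weighting the coordinates yields a quadratic
    Lyapunov function, so [e^{tB}] decays exponentially and [M t] converges to
    the positive definite matrix [K_oo]; [L] is then given by dominated
    convergence. *)

From HB Require Import structures.
From mathcomp Require Import all_boot all_order all_algebra.
From mathcomp Require Import perm complex.
From mathcomp Require Import all_classical all_reals all_analysis.
From mathcomp Require Import measurable_realfun.
From mathcomp Require Import ring lra.
Require Import Defs.

Set Implicit Arguments.
Unset Strict Implicit.
Unset Printing Implicit Defensive.

Import Order.TTheory GRing.Theory Num.Theory.
Import numFieldNormedType.Exports.

Local Open Scope classical_set_scope.
Local Open Scope ring_scope.

(** * Positive definite matrices *)

(** Positive definiteness comes from Q >= 0 together with the invertibility of K(t); for K_oo it
    comes from K_oo >= M 1. All estimates on P_t f(X) go through Gaussian averages indexed by a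
    matrix S and a mean m. P_t f(X) is the average with S = M t and m = e^{tB} X, so its continuity
    in t and its limit in the stable case are both instances of the continuity of this average in
    (S, m), where a multiple of |f| is the dominating function.

    In the unstable case no eigenvalue of M t is followed. An eigenvector of B^T with Re >= 0 yields
    real vectors along which M t grows linearly, and the adjugate bound turns the growth of any
    entry of M t into growth of its determinant.

    The rate sqrt t at 0 is that of the standard deviation of the Gaussian, seen through a Lipschitz
    constant of f. Then t^(-1-s) sqrt t is integrable at 0 for s < 1/2, and s <= 1/4 leaves the
    majorant t^(-3/4), independent of s.

    Complex numbers enter only through eigenvectors and the Schur form. They are split into real and
    imaginary parts, so that all calculus is done on real functions. *)

Section inner_product.
Variables (R : realType) (n : nat).
Implicit Types (u v w : 'cV[R]_n) (A : 'M[R]_n) (a : R).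

Lemma innerC u v : inner u v = inner v u.
Proof. by apply: eq_bigr => i _; rewrite mulrC. Qed.

Lemma innerDl u v w : inner (u + v) w = inner u w + inner v w.
Proof. by rewrite -big_split/=; apply: eq_bigr => i _; rewrite mxE mulrDl. Qed.

Lemma innerZl a u v : inner (a *: u) v = a * inner u v.
Proof. by rewrite big_distrr/=; apply: eq_bigr => i _; rewrite mxE mulrA. Qed.

Lemma innerNl u v : inner (- u) v = - inner u v.
Proof. by rewrite -scaleN1r innerZl mulN1r. Qed.

Lemma innerDr u v w : inner u (v + w) = inner u v + inner u w.
Proof. by rewrite innerC innerDl ![inner _ u]innerC. Qed.

Lemma innerZr a u v : inner u (a *: v) = a * inner u v.
Proof. by rewrite innerC innerZl innerC. Qed.

Lemma innerNr u v : inner u (- v) = - inner u v.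
Proof. by rewrite innerC innerNl innerC. Qed.

Definition innerE := (innerDl, innerDr, innerNl, innerNr, innerZl, innerZr).

Lemma inner0l u : inner 0 u = 0.
Proof. by rewrite -(scale0r 0) innerZl mul0r. Qed.

Lemma innerv_ge0 u : 0 <= inner u u.
Proof. by apply: sumr_ge0 => i _; rewrite -expr2 sqr_ge0. Qed.

Lemma innerv_eq0 u : (inner u u == 0) = (u == 0).
Proof.
apply/eqP/eqP => [u0|->]; last exact: inner0l.
apply/matrixP => i j; rewrite ord1 mxE; apply/eqP.
have h k : 0 <= u k 0 * u k 0 by rewrite -expr2 sqr_ge0.
have := psumr_eq0P (fun k _ => h k) u0 (i := i) isT.
by move/eqP; rewrite mulf_eq0 orbb.
Qed.

Lemma innerE_mx u v : inner u v = (u^T *m v) 0 0.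
Proof. by rewrite mxE; apply: eq_bigr => i _; rewrite mxE. Qed.

Lemma inner_delta A i j : inner (A *m delta_mx j 0) (delta_mx i 0) = A i j.
Proof.
rewrite -colE /inner (bigD1 i)//= big1 ?addr0 ?mxE ?eqxx ?mulr1// => k /negPf ki.
by rewrite !mxE ki mulr0.
Qed.

End inner_product.

Lemma inner_mull (R : realType) (m n : nat) (A : 'M[R]_(m, n)) u v :
  inner (A *m u) v = inner u (A^T *m v).
Proof. by rewrite !innerE_mx trmx_mul mulmxA. Qed.

Lemma inner_col_mx (R : realType) (m n : nat) (u1 v1 : 'cV[R]_m) (u2 v2 : 'cV[R]_n) :
  inner (col_mx u1 u2) (col_mx v1 v2) = inner u1 v1 + inner u2 v2.
Proof.
rewrite /inner big_split_ord/=.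
by congr (_ + _); apply: eq_bigr => i _; rewrite ?col_mxEu ?col_mxEd.
Qed.

Section posdef.
Variables (R : realType).

Definition posdef n (A : 'M[R]_n) :=
  A^T = A /\ forall v, v != 0 -> 0 < inner (A *m v) v.

Lemma posdef_ge0 n (A : 'M[R]_n) v : posdef A -> 0 <= inner (A *m v) v.
Proof.
move=> [_ A0]; have [->|/A0/ltW//] := eqVneq v 0.
by rewrite mulmx0 inner0l.
Qed.

Lemma inner_sym n (A : 'M[R]_n) u v : A^T = A ->
  inner (A *m u) v = inner (A *m v) u.
Proof. by move=> AT; rewrite inner_mull AT innerC. Qed.

(** The trial value x / (1 + c) makes the expression equal to -x^2 (2 + c) / (1 + c)^2. The exact
    minimiser x / c is avoided because c may be 0. *)
Lemma quadratic_ge0_linear0 (x c : R) : 0 <= c -> 0 <= x ->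
  (forall t, 0 <= t ^+ 2 * c - 2 * t * x) -> x = 0.
Proof.
move=> c0 x0 /(_ (x / (1 + c))) hx; apply/eqP.
rewrite eq_le x0 andbT leNgt; apply/negP => xp.
have E : (x / (1 + c)) ^+ 2 * c - 2 * (x / (1 + c)) * x =
    - (x ^+ 2 * (2 + c) / (1 + c) ^+ 2) by field; lra.
move: hx; rewrite E oppr_ge0 leNgt => /negP; apply.
by rewrite divr_gt0// ?mulr_gt0 ?exprn_gt0//; lra.
Qed.

(* A psd form vanishing at v has v as a minimiser, so its gradient A v is 0. *)
Lemma psd_inner_eq0 n (A : 'M[R]_n) v : A^T = A -> psd A ->
  inner (A *m v) v = 0 -> A *m v = 0.
Proof.
move=> AT A0 Av0; apply/eqP; rewrite -innerv_eq0.
set w := A *m v; apply/eqP.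
apply: (@quadratic_ge0_linear0 _ (inner (A *m w) w)) => [|| t].
- exact: A0.
- exact: innerv_ge0.
- have := A0 (v - t *: w).
  rewrite mulmxBr -scalemxAr !innerE Av0 -/w (inner_sym w v AT) -/w.
  by congr (_ <= _); ring.
Qed.

(** A vector at which a psd form vanishes lies in its kernel, and invertibility makes that kernel
    trivial. *)
Lemma psd_unitmx_posdef n (A : 'M[R]_n) : A^T = A -> psd A -> A \in unitmx ->
  posdef A.
Proof.
move=> AT A0 Au; split=> // v v0; rewrite lt_neqAle A0 andbT eq_sym.
apply: contra v0 => /eqP/(psd_inner_eq0 AT A0) Av0.
by rewrite -(mulKmx Au v) Av0 mulmx0.
Qed.

Lemma posdef_unitmx n (A : 'M[R]_n) : posdef A -> A \in unitmx.
Proof.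
move=> [AT A0]; rewrite -row_free_unit -kermx_eq0.
apply/eqP/row_matrixP => i; rewrite row0; apply/eqP.
set w := row i _; have wA : w *m A = 0 by rewrite -row_mul mulmx_ker row0.
apply: contraT => w0; have := A0 w^T.
rewrite -{1}AT -trmx_mul wA trmx0 inner0l ltxx; apply.
by apply: contra w0 => /eqP/(congr1 trmx); rewrite trmxK trmx0 => /eqP.
Qed.

Lemma posdef_invmx n (A : 'M[R]_n) : posdef A -> posdef (invmx A).
Proof.
move=> Ap; have Au := posdef_unitmx Ap; have [AT A0] := Ap; split.
  by rewrite trmx_inv AT.
move=> v v0; rewrite -{2}(mulKVmx Au v) innerC; apply: A0.
by apply: contra v0 => /eqP w0; rewrite -(mulKVmx Au v) w0 mulmx0.
Qed.

Lemma posdefD n (A1 A : 'M[R]_n) : posdef A1 -> A^T = A ->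
  (forall v, inner (A1 *m v) v <= inner (A *m v) v) -> posdef A.
Proof. by move=> [_ A10] AT h; split=> // v /A10/lt_le_trans; apply. Qed.

(* Both sides are compared with max_z (2<z,y> - <Az,z>) = <A^-1 y,y>. *)
Lemma invmx_antitone n (A1 A : 'M[R]_n) y : posdef A1 -> posdef A ->
  (forall v, inner (A1 *m v) v <= inner (A *m v) v) ->
  inner (invmx A *m y) y <= inner (invmx A1 *m y) y.
Proof.
move=> A1p Ap h; have A1u := posdef_unitmx A1p; have Au := posdef_unitmx Ap.
set z := invmx A *m y; set x := invmx A1 *m y.
have Az : A *m z = y by rewrite mulKVmx.
have Ax : A1 *m x = y by rewrite mulKVmx.
have h1 := h z.
have := posdef_ge0 (z - x) A1p; have [AT _] := A1p.
rewrite mulmxBr !innerE (inner_sym z x AT) Ax.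
move: h1; rewrite Az; rewrite (innerC z y) (innerC x y); lra.
Qed.

(** The form is nonnegative at e_i + e_j and at e_i - e_j. *)
Lemma psd_entry_le n (A : 'M[R]_n) i j : A^T = A -> psd A ->
  `|A i j| <= (A i i + A j j) / 2.
Proof.
move=> AT A0.
have := A0 (delta_mx i 0 + delta_mx j 0); have := A0 (delta_mx i 0 - delta_mx j 0).
rewrite !(mulmxBr, mulmxDr) !innerE !inner_delta.
have -> : A j i = A i j by rewrite -{1}AT mxE.
by rewrite ler_norml => h1 h2; apply/andP; split; lra.
Qed.

(** Leibniz formula: n! products of n entries each. *)
Lemma det_le_bound n (A : 'M[R]_n) C : (forall i j, `|A i j| <= C) ->
  `|\det A| <= n`!%:R * C ^+ n.
Proof.
move=> AC; apply: (le_trans (ler_norm_sum _ _ _)).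
apply: (@le_trans _ _ (\sum_(s : 'S_n) C ^+ n)); last first.
  by rewrite sumr_const card_Sn mulr_natl.
apply: ler_sum => s _; rewrite normrM normrX normrN1 expr1n mul1r normr_prod.
rewrite -[X in C ^+ X](card_ord n) -prodr_const; apply: ler_prod => i _.
by rewrite normr_ge0 AC.
Qed.

(** Elimination of the first coordinate, with pivot a and Schur complement S. It drives the
    inductions on the dimension, both for the sign of the determinant and for the Gaussian
    integral. *)
Lemma posdef_block n (A : 'M[R]_(1 + n)) : posdef A ->
  let a := A 0 0 in let b := dlsubmx A in
  let S := drsubmx A - a^-1 *: (b *m b^T) in
  [/\ 0 < a, A = block_mx a%:M b^T b (drsubmx A), posdef S &
      \det A = a * \det S].
Proof.
move=> Ap a b S; have [AT A0] := Ap.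
have EA : A = block_mx a%:M b^T b (drsubmx A).
  rewrite -[LHS]submxK; congr block_mx.
  - apply/matrixP => i j; rewrite !ord1 !mxE eqxx mulr1n /a.
    by congr (A _ _); apply/val_inj.
  - by rewrite /b trmx_dlsub AT.
have a0 : 0 < a.
  rewrite /a -inner_delta; apply: A0; apply/eqP => /matrixP/(_ 0 0).
  by rewrite !mxE eqxx => /eqP; rewrite oner_eq0.
have DT : (drsubmx A)^T = drsubmx A by rewrite trmx_drsub AT.
have ST : S^T = S by rewrite linearB linearZ/= trmx_mul trmxK DT.
split=> //.
- split=> // v v0.
  (* For fixed v the form is smallest at this first coordinate, and its minimum there is <S v,
     v>. *)
  pose x := - a^-1 *: (b^T *m v).
  have /A0 : col_mx x v != 0.
    by apply: contra v0 => /eqP/eqP; rewrite col_mx_eq0 => /andP[].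
  congr (_ < _); rewrite {1}EA mul_block_col inner_col_mx.
  have -> : a%:M *m x + b^T *m v = 0.
    by rewrite /x mul_scalar_mx scalerA mulrN divff ?gt_eqF// scaleN1r addNr.
  rewrite inner0l add0r /S /x mulmxBl -scalemxAl -scalemxAr scaleNr addrC.
  by rewrite mulmxA.
- have -> : A = block_mx 1%:M 0 (a^-1 *: b) 1%:M *m block_mx a%:M b^T 0 S.
    rewrite mulmx_block !mul1mx !mul0mx !addr0 mul_mx_scalar scalerA.
    rewrite divff ?gt_eqF// scale1r -scalemxAl /S addrC subrK.
    exact: EA.
  by rewrite det_mulmx det_lblock det_ublock !det1 !mul1r det_scalar1.
Qed.

Lemma posdef_det_gt0 n (A : 'M[R]_n) : posdef A -> 0 < \det A.
Proof.
elim: n A => [|n IH] A Ap; first by rewrite det_mx00.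
have [a0 _ Sp ->] := @posdef_block n A Ap.
by rewrite mulr_gt0// IH.
Qed.

(* A = det(A) adj(A^-1), and A^-1 is bounded by A1^-1. *)
Lemma posdef_le_det n (A1 : 'M[R]_n) : posdef A1 ->
  exists2 C, 0 <= C & forall A, posdef A ->
   (forall v, inner (A1 *m v) v <= inner (A *m v) v) ->
   forall i j, `|A i j| <= C * \det A.
Proof.
move=> A1p; have [I1T I10] := posdef_invmx A1p.
(* The trace dominates each diagonal entry of [invmx A1], hence of [invmx A]; [psd_entry_le] then
   bounds the off-diagonal entries. *)
pose c := \sum_i (invmx A1) i i.
have i1 i : 0 <= (invmx A1) i i.
  by rewrite -inner_delta; apply/posdef_ge0/posdef_invmx.
have c0 : 0 <= c by exact: sumr_ge0.
have ci i : (invmx A1) i i <= c.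
  by rewrite /c (bigD1 i)//= lerDl sumr_ge0.
exists (n.-1`!%:R * c ^+ n.-1); first by rewrite mulr_ge0// exprn_ge0.
move=> A Ap h i j; have Au := posdef_unitmx Ap.
have Ip := posdef_invmx Ap.
have bnd k l : `|(invmx A) k l| <= c.
  apply: (le_trans (psd_entry_le k l _ _)); first by case: Ip.
    by move=> v; exact: posdef_ge0.
  have hk m : (invmx A) m m <= c.
    apply: le_trans (ci m); rewrite -2!inner_delta.
    exact: invmx_antitone.
  by have := hk k; have := hk l; lra.
rewrite -{1}(invmxK A) {1}/invmx unitmx_inv Au mxE normrM det_inv invrK.
rewrite mulrC (gtr0_norm (posdef_det_gt0 Ap)) ler_wpM2r ?(ltW (posdef_det_gt0 Ap))//.
rewrite mxE /cofactor normrM normrX normrN1 expr1n mul1r.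
by apply: det_le_bound => k l; rewrite !mxE.
Qed.

End posdef.

(** * Integration on R^n and the Gaussian integral *)

Section lebesgue_tuple_theory.
Variable R : realType.
Local Notation RT := (measurableTypeR R).
Local Notation mu := (@lebesgue_measure R).

Lemma measurable_fst_behead n :
  measurable_fun [set: n.+1.-tuple RT]
    (fun t => (thead t, [tuple of behead t]) : RT * n.-tuple RT).
Proof.
apply/measurable_fun_pairP; split.
  exact: (@measurable_tnth _ RT n.+1 ord0).
exact: measurable_behead.
Qed.

(** Required by Tonelli's theorem. The exhausting sequences G and F are taken nondecreasing so that
    the products [G k] x [F k] with a common index still cover the space. *)
Lemma sigma_finite_lebesgue_tuple n :
  sigma_finite [set: n.-tuple RT] (@lebesgue_tuple R n).
Proof.
elim: n => [|n [F TF mF]].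
  apply: fin_num_fun_sigma_finite; first by rewrite measure0.
  by move=> A mA /=; rewrite diracE.
have /sigma_finiteP[G [TG ndG Goo]] := sigma_finiteT mu.
have /sigma_finiteP[{TF mF}F [TF ndF Foo]] : sigma_finite setT (@lebesgue_tuple R n).
  by exists F.
exists (fun k => (fun t : n.+1.-tuple RT =>
    (thead t, [tuple of behead t]) : RT * n.-tuple RT) @^-1` (G k `*` F k)).
  apply/seteqP; split=> // t _.
  have : [set: RT] (thead t) by [].
  have : [set: n.-tuple RT] [tuple of behead t] by [].
  rewrite {1}TF {1}TG => -[i _ Fi] [j _ Gj]; exists (maxn i j) => //; split=> /=.
    by move: Gj; apply: (subsetPset _ _ (ndG _ _ (leq_maxr _ _))).
  by move: Fi; apply: (subsetPset _ _ (ndF _ _ (leq_maxl _ _))).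
move=> k; have [mG Gk] := Goo k; have [mF Fk] := Foo k; split.
  rewrite -[X in measurable X]setTI; apply: measurable_fst_behead => //.
  exact: measurableX.
rewrite /= /lebesgue_cons /pushforward.
rewrite (_ : _ @^-1` _ = G k `*` F k).
  by rewrite product_measure2E// lte_mul_pinfty// ge0_fin_numE.
apply/seteqP; split=> -[x y] /=; rewrite theadE (_ : [tuple of _] = y)//;
  exact/val_inj.
Qed.

(* [lebesgue_tuple n] is already bundled as a measure; the sigma-finite structure
   has to be attached to the underlying set function. *)
Definition lebesgue_tuple_fun n : set (n.-tuple RT) -> \bar R := @lebesgue_tuple R n.

HB.instance Definition _ n := isMeasure.Build _ _ _ (@lebesgue_tuple_fun n)
  (@measure0 _ _ _ (@lebesgue_tuple R n)) (@measure_ge0 _ _ _ (@lebesgue_tuple R n))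
  (@measure_semi_sigma_additive _ _ _ (@lebesgue_tuple R n)).

HB.instance Definition _ n := Measure_isSigmaFinite.Build _ _ _
  (@lebesgue_tuple_fun n) (sigma_finite_lebesgue_tuple n).

Lemma integral_lebesgue_tupleS n (f : n.+1.-tuple RT -> \bar R) :
  measurable_fun setT f -> (forall y, 0 <= f y)%E ->
  (\int[@lebesgue_tuple R n.+1]_y f y =
   \int[@lebesgue_tuple R n]_y \int[mu]_x f (tuple_cons (x, y)))%E.
Proof.
move=> mf f0.
pose g (p : RT * n.-tuple RT) := f (tuple_cons p).
have mg : measurable_fun setT g.
  exact: (measurableT_comp mf (@measurable_tuple_cons R n)).
transitivity (\int[(mu \x^ @lebesgue_tuple R n)]_p g p)%E.
  rewrite /= (@ge0_integral_pushforward _ _ _ _ _ _ (@measurable_tuple_cons R n))//.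
(* [lebesgue_cons] is built on the product [\x^], while Tonelli is applied to [\x]. Both agree on
   rectangles, hence everywhere by uniqueness of the product measure. *)
transitivity (\int[(mu \x @lebesgue_tuple_fun n)]_p g p)%E.
  apply: eq_measure_integral => A mA _.
  apply/esym/product_measure_unique => // C D mC mD.
  exact: product_measure2E.
rewrite fubini_tonelli2; [by []|exact: mg|by move=> p; exact: f0].
Qed.

Lemma integral_lebesgue_tuple0 (f : 0.-tuple RT -> \bar R) :
  (\int[@lebesgue_tuple R 0]_y f y = f [tuple])%E.
Proof.
rewrite (_ : f = cst (f [tuple])); last first.
  by apply/funext => t; rewrite tuple0.
by rewrite /= integral_dirac// diracT mul1e.
Qed.

Definition vec n (y : n.-tuple RT) : 'cV[R]_n := \col_i tnth y i.

Lemma vec_cons n (p : RT * n.-tuple RT) :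
  vec (tuple_cons p) = col_mx (p.1)%:M (vec p.2) :> 'cV[R]_(1 + n).
Proof.
apply/matrixP => i j; rewrite ord1 !mxE.
case: splitP => k ik; rewrite !mxE.
  by rewrite (_ : i = ord0) ?ord1 ?eqxx ?mulr1n//; apply/val_inj; rewrite /= ik ord1.
have -> : i = lift ord0 k by apply/val_inj; rewrite /= ik.
by rewrite tnthS; congr tnth; exact/val_inj.
Qed.

Lemma measurable_vec n i j : measurable_fun setT (fun y : n.-tuple RT => vec y i j).
Proof.
rewrite (_ : (fun _ => _) = (fun y => tnth y i)); first exact: measurable_tnth.
by apply/funext => y; rewrite mxE.
Qed.

Lemma measurable_inner_vec n (A : 'M[R]_n) (m1 m2 : 'cV[R]_n) :
  measurable_fun setT (fun y : n.-tuple RT => inner (A *m (vec y - m1)) (vec y - m2)).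
Proof.
have mv (m : 'cV[R]_n) i : measurable_fun setT (fun y : n.-tuple RT => (vec y - m) i 0).
  rewrite (_ : (fun _ => _) = (fun y => vec y i 0 - m i 0)); last first.
    by apply/funext => y; rewrite !mxE.
  by apply: measurable_funB => //; exact: measurable_vec.
apply: measurable_sum => i; apply: measurable_funM => //.
rewrite (_ : (fun _ => _) = (fun y => \sum_j A i j * (vec y - m1) j 0)); last first.
  by apply/funext => y; rewrite mxE.
by apply: measurable_sum => j; apply: measurable_funM.
Qed.

Lemma integral_gauss1 (a c : R) : 0 < a ->
  (\int[mu]_x (expR (- (a * (x - c) ^+ 2 / 4)))%:E = (Num.sqrt (4 * pi / a))%:E)%E.
Proof.
(* Matching a (x - c)^2 / 4 with (x - c)^2 / (2 s^2) gives s^2 = 2 / a. *)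
move=> a0; pose s := Num.sqrt (2 / a).
have s2 : s ^+ 2 = 2 / a by rewrite sqr_sqrtr// divr_ge0// ltW.
have s0 : s != 0 by rewrite gt_eqF// sqrtr_gt0 divr_gt0.
have E x : expR (- (a * (x - c) ^+ 2 / 4)) = (normal_peak s)^-1 * normal_pdf c s x.
  rewrite normal_pdfE// mulrA mulVf ?gt_eqF ?normal_peak_gt0// mul1r.
  rewrite /normal_fun s2; congr expR; rewrite -mulr_natr; field.
  by rewrite gt_eqF.
under eq_integral do rewrite E EFinM.
rewrite integralZl//; last exact: integrable_normal_pdf.
rewrite integral_normal_pdf mule1 /normal_peak invrK s2; congr (Num.sqrt _)%:E.
by rewrite -mulr_natr; field; rewrite gt_eqF.
Qed.

(** Induction on the dimension. Completing the square in the first coordinate leaves the form of the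
    Schur complement S; the one-dimensional integral contributes sqrt(4 pi / a), and det A = a det
    S. *)
Lemma integral_gauss n (A : 'M[R]_n) (m : 'cV[R]_n) : posdef A ->
  (\int[@lebesgue_tuple R n]_y
     (expR (- (inner (A *m (vec y - m)) (vec y - m) / 4)))%:E =
   ((4 * pi) `^ (n%:R / 2) / Num.sqrt (\det A))%:E)%E.
Proof.
have mE k (C : 'M[R]_k) (l : 'cV[R]_k) : measurable_fun setT (fun y : k.-tuple RT =>
    (expR (- (inner (C *m (vec y - l)) (vec y - l) / 4)))%:E).
  apply/measurable_EFinP; apply: measurableT_comp => //.
  apply: measurableT_comp => //; apply: measurable_funM => //.
  exact: measurable_inner_vec.
elim: n A m => [|n IH] A m Ap.
  rewrite integral_lebesgue_tuple0 /inner big_ord0 mul0r oppr0 expR0.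
  by rewrite mul0r powRr0 det_mx00 sqrtr1 divr1.
rewrite integral_lebesgue_tupleS//.
pose A' : 'M[R]_(1 + n) := A; pose m' : 'cV[R]_(1 + n) := m.
have [a0 EA Sp dA] := @posdef_block R n A' Ap.
set a := A' 0 0 in a0 EA Sp dA; set b := dlsubmx A' in EA Sp dA.
set S := _ - _ in Sp dA.
have [ST _] := Sp.
(* Centre of the Gaussian in the first coordinate when the other coordinates are fixed. *)
pose c y := usubmx m' 0 0 - a^-1 * inner b (vec y - dsubmx m').
have E x y :
    expR (- (inner (A *m (vec (tuple_cons (x, y)) - m))
                   (vec (tuple_cons (x, y)) - m) / 4)) =
    expR (- (inner (S *m (vec y - dsubmx m')) (vec y - dsubmx m') / 4)) *
    expR (- (a * (x - c y) ^+ 2 / 4)).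
  rewrite -expRD; congr expR.
  have -> : vec (tuple_cons (x, y)) - m =
      col_mx (x%:M - usubmx m') (vec y - dsubmx m') :> 'cV_(1 + n).
    transitivity (col_mx x%:M (vec y) - m' : 'cV_(1 + n)).
      by congr (_ - _); rewrite vec_cons.
    by rewrite -{1}(vsubmxK m') opp_col_mx add_col_mx.
  set z := vec y - _.
  have -> : x%:M - usubmx m' = (x - usubmx m' 0 0)%:M.
    by rewrite {1}[usubmx m']mx11_scalar -raddfB.
  set w := x - _.
  change (- (inner (A' *m col_mx w%:M z) (col_mx w%:M z) / 4) =
    - (inner (S *m z) z / 4) - a * (x - c y) ^+ 2 / 4).
  have -> : x - c y = w + a^-1 * inner b z by rewrite /c /w opprB addrA addrAC.
  clearbody z w.
  have bz : b^T *m z = (inner b z)%:M.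
    by rewrite [LHS]mx11_scalar innerE_mx.
  rewrite {1}EA mul_block_col inner_col_mx /S mulmxBl -scalemxAl.
  rewrite -mulmxA bz -scalar_mxM -raddfD /= !mul_mx_scalar !innerE.
  rewrite [inner _%:M _]/inner big_ord1 !mxE eqxx !mulr1n.
  by field; rewrite gt_eqF.
under eq_integral => y _.
  under eq_integral do rewrite E EFinM.
  rewrite ge0_integralZl//; last first.
  - apply/measurable_EFinP; apply: measurableT_comp => //.
    apply: measurableT_comp => //; apply: measurable_funM => //.
    apply: measurable_funM => //; apply: measurable_funX.
    exact: measurable_funB.
  rewrite integral_gauss1//.
  over.
rewrite ge0_integralZr//; last exact: mE.
rewrite IH// -EFinM; congr EFin; rewrite dA.
have p4 : 0 < 4 * pi :> R by rewrite mulr_gt0 ?pi_gt0.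
rewrite -[n.+1%:R]natr1 (mulrDl n%:R) powRD ?(gt_eqF p4) ?implybT//.
rewrite mul1r powR12_sqrt ?ltW//.
rewrite !sqrtrM ?(ltW a0) ?(ltW p4)// sqrtrV ?(ltW a0)//.
by rewrite invfM; ring.
Qed.

End lebesgue_tuple_theory.

(** * Limits of matrices *)

Section matrix_limits.
Context {R : realType} {T : Type} {F : set_system T} {FF : Filter F}.

Lemma cvg_mx m n (f : T -> 'M[R]_(m, n)) (M : 'M[R]_(m, n)) :
  (forall i j, f t i j @[t --> F] --> M i j) -> f t @[t --> F] --> M.
Proof.
move=> h; apply/cvg_ballP => e e0.
have /= nh (ij : 'I_m * 'I_n) := cvg_ball (h ij.1 ij.2) e0.
have nn := filter_forall FF (nh FF).
near=> t.
have ht (ij : 'I_m * 'I_n) : ball (M ij.1 ij.2) e (f t ij.1 ij.2).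
  by move: ij; near: t.
by split => // i j; exact: (ht (i, j)).
Unshelve. all: by end_near. Qed.

Lemma cvg_coord m n (f : T -> 'M[R]_(m, n)) (M : 'M[R]_(m, n)) i j :
  f t @[t --> F] --> M -> f t i j @[t --> F] --> M i j.
Proof.
by move=> h; apply: (cvg_comp f (fun N : 'M[R]_(m, n) => N i j) h);
  exact: coord_continuous.
Qed.

Lemma cvg_sum_fin (I : finType) (f : T -> I -> R) (l : I -> R) :
  (forall i, f t i @[t --> F] --> l i) ->
  \sum_i f t i @[t --> F] --> \sum_i l i.
Proof.
move=> fl; rewrite unlock /=; elim: (index_enum I) => [|i s IH] /=.
  exact: cvg_cst.
exact: cvgD.
Qed.

Lemma cvg_prod_fin (I : finType) (f : T -> I -> R) (l : I -> R) :
  (forall i, f t i @[t --> F] --> l i) ->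
  \prod_i f t i @[t --> F] --> \prod_i l i.
Proof.
move=> fl; rewrite unlock /=; elim: (index_enum I) => [|i s IH] /=.
  exact: cvg_cst.
exact: cvgM.
Qed.

Lemma cvg_mulmx m n p (f : T -> 'M[R]_(m, n)) (g : T -> 'M[R]_(n, p))
    (A : 'M[R]_(m, n)) (B : 'M[R]_(n, p)) :
  f t @[t --> F] --> A -> g t @[t --> F] --> B ->
  f t *m g t @[t --> F] --> A *m B.
Proof.
move=> fA gB; apply: cvg_mx => i j.
rewrite mxE; under eq_cvg do rewrite mxE.
by apply: cvg_sum_fin => k; apply: cvgM; exact: cvg_coord.
Qed.

Lemma cvg_trmx m n (f : T -> 'M[R]_(m, n)) (A : 'M[R]_(m, n)) :
  f t @[t --> F] --> A -> (f t)^T @[t --> F] --> A^T.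
Proof.
move=> fA; apply: cvg_mx => i j; rewrite mxE; under eq_cvg do rewrite mxE.
exact: cvg_coord.
Qed.

Lemma cvg_inner n (f g : T -> 'cV[R]_n) (u v : 'cV[R]_n) :
  f t @[t --> F] --> u -> g t @[t --> F] --> v ->
  inner (f t) (g t) @[t --> F] --> inner u v.
Proof.
by move=> fu gv; apply: cvg_sum_fin => i; apply: cvgM; exact: cvg_coord.
Qed.

Lemma cvg_det n (f : T -> 'M[R]_n) (A : 'M[R]_n) :
  f t @[t --> F] --> A -> \det (f t) @[t --> F] --> \det A.
Proof.
move=> fA; apply: cvg_sum_fin => s; apply: cvgM; first exact: cvg_cst.
by apply: cvg_prod_fin => i; exact: cvg_coord.
Qed.

(** The adjugate formula expresses the inverse through determinants, which are continuous.
    Invertibility of [f t] selects this branch of [invmx], which returns its argument on a singular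
    matrix. *)
Lemma cvg_invmx n (f : T -> 'M[R]_n) (A : 'M[R]_n) : A \in unitmx ->
  (\forall t \near F, f t \in unitmx) ->
  f t @[t --> F] --> A -> invmx (f t) @[t --> F] --> invmx A.
Proof.
move=> Au fu fA.
have h : (\det (f t))^-1 *: \adj (f t) @[t --> F] --> (\det A)^-1 *: \adj A.
  apply: cvg_mx => i j; rewrite mxE; under eq_cvg do rewrite mxE.
  apply: cvgM.
    apply: cvgV; first by rewrite -unitfE -unitmxE.
    exact: cvg_det.
  rewrite mxE; under eq_cvg do rewrite mxE.
  apply: cvgM; first exact: cvg_cst.
  apply: cvg_det; apply: cvg_mx => k l; rewrite !mxE; under eq_cvg do rewrite !mxE.
  exact: cvg_coord.
rewrite {2}/invmx Au; apply: cvg_trans h.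
by apply: near_eq_cvg; near=> t; rewrite /invmx ifT//; near: t.
Unshelve. all: by end_near. Qed.

End matrix_limits.

(** * Measurability and integrability of Schwartz functions *)

Section schwartz_integrable.
Variable R : realType.
Local Notation RT := (measurableTypeR R).
Local Notation mu := (@lebesgue_measure R).

(* f is the pointwise limit of its values at the points of the grids (1/(k+1)) Z^n. *)
Lemma measurable_vec_continuous n (f : 'cV[R]_n -> R) : continuous f ->
  measurable_fun setT (fun y : n.-tuple RT => f (vec y)).
Proof.
move=> cf.
pose fl k x : int := Num.floor (k.+1%:R * x : R).
pose g k (z : 'I_n -> int) : 'cV[R]_n := \col_i ((z i)%:~R / k.+1%:R).
apply: (@measurable_fun_cvg _ _ _ _
    (fun k y => f (g k (fun i => fl k (tnth y i))))) => [k|y _].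
  move=> _ Y mY; rewrite setTI.
  (* The approximant takes one value on each grid box, so a preimage is a countable union, over grid
     points z, of the box at z intersected with the whole space or the empty set. *)
  rewrite (_ : _ @^-1` _ = \bigcup_(z : {ffun 'I_n -> int})
    ((\bigcap_(i in [set: 'I_n])
      ((fun y : n.-tuple RT => tnth y i) @^-1` [set x | fl k x = z i])) `&`
    [set y | Y (f (g k z))])).
    apply: countable_bigcupT_measurable => [|z]; first exact: countableP.
    have [h|h] := pselect (Y (f (g k z))); last first.
      by rewrite (_ : [set y | _] = set0) ?setI0//; apply/seteqP; split.
    rewrite (_ : [set y | _] = setT) ?setIT//; last by apply/seteqP; split.
    apply: fin_bigcap_measurable => [|i _]; first exact: finite_finset.
    rewrite -[X in measurable X]setTI; apply: measurable_tnth => //.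
    rewrite (_ : [set x | _] = `[(z i)%:~R / k.+1%:R, (z i + 1)%:~R / k.+1%:R[%classic)//.
    apply/seteqP; split=> x /=.
      move=> <-; rewrite in_itv/= ler_pdivrMr// ltr_pdivlMr// mulrC.
      by rewrite ge_floor lt_succ_floor.
    rewrite in_itv/= ler_pdivrMr// ltr_pdivlMr// mulrC => /andP[h1 h2].
    by apply/floor_def; rewrite h1 h2.
  apply/seteqP; split => y /=.
    move=> Yy; exists [ffun i => fl k (tnth y i)] => //; split.
      by move=> i _ /=; rewrite ffunE.
    by rewrite (_ : g k _ = g k (fun i => fl k (tnth y i)))//; apply/colP => i;
      rewrite !mxE ffunE.
  move=> [z _ [zy]]; rewrite (_ : g k z = g k (fun i => fl k (tnth y i)))//.
  by apply/colP => i; rewrite !mxE -(zy i).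
suff h : g k (fun i => fl k (tnth y i)) @[k --> \oo] --> vec y.
  exact: (cvg_comp _ f h (cf (vec y))).
apply: cvg_mx => i j; rewrite mxE; under eq_cvg do rewrite mxE.
apply/cvgrPdist_le => e e0.
near=> k.
have k0 : 0 < k.+1%:R :> R by [].
have kn0 : k.+1%:R != 0 :> R by rewrite gt_eqF.
rewrite -{1}(mulfK kn0 (tnth y i)) -mulrBl normrM normfV (gtr0_norm k0).
rewrite ler_pdivrMr//.
have h1 : `|tnth y i * k.+1%:R - (fl k (tnth y i))%:~R| <= 1.
  rewrite ger0_norm; last by rewrite subr_ge0 mulrC ge_floor.
  by rewrite lerBlDl mulrC ltW// -intrD1 lt_succ_floor.
apply: (le_trans h1); rewrite mulrC -ler_pdivrMr//.
have : e^-1 <= k%:R.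
  near: k; exact: nbhs_infty_ger.
by rewrite div1r => /le_trans; apply; rewrite ler_nat.
Unshelve. all: by end_near. Qed.

(** By Tonelli the integral is the n-th power of the one-dimensional one. Such products are the
    majorants of Schwartz functions. *)
Lemma integral_prod_tuple n (g : R -> R) : measurable_fun setT g ->
  (forall x, 0 <= g x) -> mu.-integrable setT (EFin \o g) ->
  (@lebesgue_tuple R n).-integrable setT
    (fun y => (\prod_i g (tnth y i))%:E).
Proof.
move=> mg g0 ig.
have mp k : measurable_fun setT (fun y : k.-tuple RT => \prod_i g (tnth y i)).
  apply: measurable_prod => i _; apply: measurableT_comp => //.
  exact: measurable_tnth.
have p0 k (y : k.-tuple RT) : 0 <= \prod_i g (tnth y i) by exact: prodr_ge0.
apply/integrableP; split; first by apply/measurable_EFinP; exact: mp.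
under eq_integral do rewrite /= ger0_norm ?p0//.
suff -> : (\int[@lebesgue_tuple R n]_y (\prod_i g (tnth y i))%:E =
    ((\int[mu]_x g x) ^+ n)%:E)%E by rewrite ltry.
elim: n => [|n IH].
  by rewrite integral_lebesgue_tuple0 big_ord0 expr0.
rewrite integral_lebesgue_tupleS; last 2 first.
- by apply/measurable_EFinP; exact: mp.
- by move=> y; rewrite lee_fin prodr_ge0.
have E x (y : n.-tuple RT) :
    \prod_i g (tnth (tuple_cons (x, y)) i) = \prod_i g (tnth y i) * g x.
  rewrite big_ord_recl tnth0 mulrC; congr (_ * _).
  by apply: eq_bigr => i _; rewrite tnthS; congr (g (tnth _ _)); exact/val_inj.
under eq_integral => y _.
  under eq_integral do rewrite E EFinM.
  rewrite ge0_integralZl//=; [|exact/measurable_EFinP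
    |by move=> x _; rewrite lee_fin|by rewrite lee_fin p0].
  over.
rewrite ge0_integralZr//=; last 3 first.
- by apply/measurable_EFinP; exact: mp.
- by move=> y _; rewrite lee_fin p0.
- by apply: integral_ge0 => x _; rewrite lee_fin.
rewrite IH exprSr EFinM; congr (_ * _)%E.
by rewrite /Rintegral fineK//; exact: integrable_fin_num.
Qed.

Lemma integrable_oneDsqrV : mu.-integrable setT (EFin \o (fun x : R => (1 + x ^+ 2)^-1)).
Proof.
have p x : 0 <= (1 + x ^+ 2)^-1 :> R by rewrite invr_ge0 addr_ge0// sqr_ge0.
have m : measurable_fun setT (fun x : R => (1 + x ^+ 2)^-1).
  by apply: continuous_measurable_fun; exact: continuous_oneDsqrV.
apply/integrableP; split; first exact/measurable_EFinP.
under eq_integral do rewrite /= ger0_norm//.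
rewrite ge0_symfun_integralT//; last 2 first.
- exact: continuous_oneDsqrV.
- by move=> x /=; rewrite sqrrN.
rewrite (_ : [set x | _] = `[0, +oo[%classic); last first.
  by apply/seteqP; split=> x /=; rewrite in_itv/= andbT.
by rewrite integral0y_oneDsqr -EFinM ltry.
Qed.

Lemma schwartz_continuous n (f : 'cV[R]_n -> R) : schwartz f -> continuous f.
Proof. by move=> [df _] x; apply: differentiable_continuous; exact: (df [::] x). Qed.

(* Summing the seminorm bounds over all monomials prod_(i in J) x_i^2. *)
Lemma schwartz_prod_bound n (f : 'cV[R]_n -> R) : schwartz f ->
  exists2 C, 0 <= C & forall x, `|f x| <= C * \prod_i (1 + x i 0 ^+ 2)^-1.
Proof.
move=> [_ bf].
have /choice[C HC] : forall J : {set 'I_n}, exists C : R, forall x : 'cV[R]_n,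
    `|(\prod_i (if i \in J then x i 0 ^+ 2 else 1)) * f x| <= C.
  move=> J; have [C HC] := bf (fun i => if i \in J then 2%N else 0%N) [::].
  exists C => x; apply: le_trans (HC x); rewrite /partials/=.
  rewrite (eq_bigr (fun i => x i 0 ^+ (if i \in J then 2 else 0)))//.
  by move=> i _; case: ifP.
have C0 J : 0 <= C J by apply: le_trans (HC J 0); exact: normr_ge0.
exists (\sum_J C J); first exact: sumr_ge0.
move=> x; have pp : 0 < \prod_i (1 + x i 0 ^+ 2).
  by apply: prodr_gt0 => i _; rewrite ltr_pwDl// sqr_ge0.
rewrite prodfV ler_pdivlMr// -(gtr0_norm pp) -normrM mulrC.
under eq_bigr do rewrite addrC.
rewrite bigA_distr mulr_suml; apply: le_trans (ler_norm_sum _ _ _) _.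
by apply: ler_sum => J _; exact: HC.
Qed.

Lemma schwartz_integrable n (f : 'cV[R]_n -> R) : schwartz f ->
  (@lebesgue_tuple R n).-integrable setT (fun y => (f (vec y))%:E).
Proof.
move=> sf; have [C C0 fC] := schwartz_prod_bound sf.
have := integral_prod_tuple n (continuous_measurable_fun (@continuous_oneDsqrV R)).
move=> /(_ _ integrable_oneDsqrV) h.
apply: (le_integrable measurableT _ _ (integrableZl measurableT C (h _))).
- apply/measurable_EFinP; apply: measurable_vec_continuous.
  exact: schwartz_continuous.
- move=> y _ /=; rewrite lee_fin; apply: (le_trans (fC _)).
  rewrite [leRHS]ger0_norm; last by rewrite mulr_ge0// prodr_ge0.
  by under eq_bigr do rewrite mxE.
- by move=> x; rewrite invr_ge0 addr_ge0// sqr_ge0.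
Qed.

Lemma schwartz_bounded n (f : 'cV[R]_n -> R) : schwartz f ->
  exists2 C, 0 <= C & forall x, `|f x| <= C.
Proof.
move=> [_ /(_ (fun=> 0%N) [::])[C HC]].
have h x : `|f x| <= C.
  apply: le_trans (HC x); rewrite big1 ?mul1r// => i _; exact: expr0.
by exists C => //; apply: le_trans (h 0); exact: normr_ge0.
Qed.

End schwartz_integrable.

(** * The matrix exponential *)

Section matrix_exponential.
Variables (R : realType).

(** The entrywise l^1 norm. By [mulmx_entry_le], left multiplication by M enlarges the maximum entry
    by at most this factor. *)
Definition mxsum m n (M : 'M[R]_(m, n)) : R := \sum_i \sum_j `|M i j|.

Lemma mxsum_ge0 m n (M : 'M[R]_(m, n)) : 0 <= mxsum M.
Proof. by apply: sumr_ge0 => i _; apply: sumr_ge0. Qed.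

Lemma row_le_mxsum m n (M : 'M[R]_(m, n)) i : \sum_j `|M i j| <= mxsum M.
Proof.
rewrite /mxsum [leRHS](bigD1 i)//= lerDl.
by apply: sumr_ge0 => k _; apply: sumr_ge0.
Qed.

Lemma mulmx_entry_le m n p (M : 'M[R]_(m, n)) (A : 'M[R]_(n, p)) c i j :
  (forall k l, `|A k l| <= c) -> 0 <= c -> `|(M *m A) i j| <= mxsum M * c.
Proof.
move=> Ac c0.
rewrite mxE; apply: le_trans (ler_norm_sum _ _ _) _.
apply: (@le_trans _ _ ((\sum_k `|M i k|) * c)).
  by rewrite mulr_suml; apply: ler_sum => k _; rewrite normrM ler_wpM2l.
by rewrite ler_wpM2r// row_le_mxsum.
Qed.

Variables (m n : nat).
Implicit Types (A : 'M[R]_n) (M : 'M[R]_(m, n)) (t : R).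

Lemma expr_entry_le A k i j : `|(A ^+ k) i j| <= mxsum A ^+ k.
Proof.
elim: k i j => [|k IH] i j.
  by rewrite !expr0 mxE; case: eqP; rewrite ?normr1 ?normr0.
rewrite exprS [leRHS]exprS; apply: mulmx_entry_le => //.
by rewrite exprn_ge0// mxsum_ge0.
Qed.

Lemma exprZmx A t k : (t *: A) ^+ k = t ^+ k *: A ^+ k.
Proof.
elim: k => [|k IH]; first by rewrite !expr0 scale1r.
by rewrite !exprS IH -!mulmxE -scalemxAl -scalemxAr scalerA.
Qed.

(** Power series coefficients, in t, of the entry (i, j) of M e^{tA}. The left factor M is kept free
    so that the family is stable under differentiation, which replaces M by M A. *)
Definition expmx_coeff M A i j : R^nat := fun k => (M *m A ^+ k) i j / k`!%:R.

Lemma expmx_coeffS M A i j :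
  pseries_diffs (expmx_coeff M A i j) = expmx_coeff (M *m A) A i j.
Proof.
apply/funext => k; rewrite /pseries_diffs /expmx_coeff exprS -mulmxE mulmxA.
rewrite factS natrM; field; rewrite !pnatr_eq0 -lt0n fact_gt0 /=.
by rewrite addrC natr1 pnatr_eq0.
Qed.

(** Absolute convergence, by comparison with [mxsum M] times the exponential series at [mxsum A]
    |t|. *)
Lemma is_cvg_expmx_coeff M A i j t : cvgn (pseries (expmx_coeff M A i j) t).
Proof.
apply: normed_cvg.
apply: (@series_le_cvg _ _ (mxsum M *: exp_coeff (mxsum A * `|t|))) => [k|k|k|].
- exact: normr_ge0.
- rewrite /= mulr_ge0 ?mxsum_ge0// /exp_coeff divr_ge0 ?exprn_ge0//.
  by rewrite mulr_ge0 ?mxsum_ge0.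
- rewrite /= /expmx_coeff !normrM normrX normfV normr_nat.
  have -> : (mxsum M *: exp_coeff (mxsum A * `|t|)) k =
      mxsum M * mxsum A ^+ k / k`!%:R * `|t| ^+ k.
    by rewrite /exp_coeff /= -[LHS]/(_ * _) exprMn; ring.
  rewrite ler_wpM2r ?exprn_ge0// ler_wpM2r ?invr_ge0//.
  apply: mulmx_entry_le => [k' l|]; first exact: expr_entry_le.
  by rewrite exprn_ge0// mxsum_ge0.
- apply: is_cvg_seriesZ; exact: is_cvg_series_exp_coeff.
Qed.

End matrix_exponential.

Section matrix_exponential_derivative.
Variables (R : realType) (n : nat).
Implicit Types (A : 'M[R]_n) (t : R).

(** [expmx] is a [limn], which carries information only once the partial sums are known to converge.
    Entrywise they are the scalar power series above. *)
Lemma cvg_expmx A t :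
  series (fun k => (k`!%:R)^-1 *: (t *: A) ^+ k) @ \oo --> expmx (t *: A).
Proof.
pose L : 'M[R]_n := \matrix_(i, j) limn (pseries (expmx_coeff 1%:M A i j) t).
suff h : series (fun k => (k`!%:R)^-1 *: (t *: A) ^+ k) @ \oo --> L.
  by rewrite /expmx (cvg_lim _ h).
apply: cvg_mx => i j; rewrite mxE.
have := @is_cvg_expmx_coeff R n n 1%:M A i j t; apply: cvg_trans.
apply: near_eq_cvg; near=> N; rewrite /series/= summxE; apply: eq_bigr => k _.
rewrite /expmx_coeff /= mul1mx exprZmx !mxE; ring.
Unshelve. all: by end_near. Qed.

Lemma expmx_entryE m (M : 'M[R]_(m, n)) A t i j :
  (M *m expmx (t *: A)) i j = limn (pseries (expmx_coeff M A i j) t).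
Proof.
apply/esym/cvg_lim => //.
have : (M *m series (fun k => (k`!%:R)^-1 *: (t *: A) ^+ k) m) i j
    @[m --> \oo] --> (M *m expmx (t *: A)) i j.
  by apply: cvg_coord; apply: cvg_mulmx; [exact: cvg_cst|exact: cvg_expmx].
apply: cvg_trans; apply: near_eq_cvg; near=> N.
rewrite /series /pseries/= mulmx_sumr summxE; apply: eq_bigr => k _.
by rewrite /expmx_coeff exprZmx -!scalemxAr !mxE; ring.
Unshelve. all: by end_near. Qed.

Lemma is_derive_expmxl m (M : 'M[R]_(m, n)) A t i j :
  is_derive t 1 (fun t => (M *m expmx (t *: A)) i j) ((M *m A *m expmx (t *: A)) i j).
Proof.
rewrite expmx_entryE -expmx_coeffS.
rewrite (_ : (fun t => _) = fun t => limn (pseries (expmx_coeff M A i j) t)); last first.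
  by apply/funext => x; rewrite expmx_entryE.
(* Termwise differentiation needs convergence at some radius beyond |t|. The series and its formal
   derivatives converge everywhere, so |t| + 1 serves. *)
apply: (@pseries_snd_diffs _ _ (`|t| + 1)); rewrite ?expmx_coeffS;
  try exact: is_cvg_expmx_coeff.
by rewrite ltr_normr ltrDl ltr01.
Qed.

Lemma expmx0 A : expmx (0 *: A) = 1%:M.
Proof.
apply: (cvg_lim _ _) => //; rewrite scale0r.
apply: cvg_near_cst; near=> N.
have m0 : (0 < N)%N by near: N; exact: nbhs_infty_gt.
rewrite /series/= -(prednK m0) big_nat_recl//= big1 ?addr0; last first.
  by move=> k _; rewrite expr0n scaler0.
by rewrite expr0 fact0 invr1 scale1r.
Unshelve. all: by end_near. Qed.

Lemma trmx_expmx A t : (expmx (t *: A))^T = expmx (t *: A^T).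
Proof.
apply/esym/cvg_lim => //.
have : (series (fun k => (k`!%:R)^-1 *: (t *: A) ^+ k) m)^T @[m --> \oo]
    --> (expmx (t *: A))^T by apply: cvg_trmx; exact: cvg_expmx.
apply: cvg_trans; apply: near_eq_cvg.
near=> N; rewrite /series/= linear_sum/=; apply: eq_bigr => k _.
rewrite linearZ/=; congr (_ *: _); rewrite !exprZmx linearZ/=; congr (_ *: _).
elim: k => [|k IH]; first by rewrite !expr0 trmx1.
by rewrite exprS exprSr trmx_mul IH.
Unshelve. all: by end_near. Qed.

End matrix_exponential_derivative.

(** * The covariance integral t K(t) *)

Section Rintegral_extra.
Context d (T : measurableType d) (R : realType) (mu : {measure set T -> \bar R}).

Lemma integrable_sum_fin (I : Type) (s : seq I) (D : set T) (f : I -> T -> R) :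
  measurable D -> (forall i, mu.-integrable D (EFin \o f i)) ->
  mu.-integrable D (EFin \o (fun x => \sum_(i <- s) f i x)).
Proof.
move=> mD fi; elim: s => [|i s IH].
  rewrite (_ : _ \o _ = cst 0%E); first exact: integrable0.
  by apply/funext => x /=; rewrite big_nil.
rewrite (_ : _ \o _ = (EFin \o f i) \+ (EFin \o (fun x => (\sum_(i <- s) f i x)%R)))%E.
  exact: integrableD.
by apply/funext => x /=; rewrite big_cons.
Qed.

Lemma Rintegral_sum_fin (I : Type) (s : seq I) (D : set T) (f : I -> T -> R) :
  measurable D -> (forall i, mu.-integrable D (EFin \o f i)) ->
  \int[mu]_(x in D) (\sum_(i <- s) f i x) = \sum_(i <- s) \int[mu]_(x in D) f i x.
Proof.
move=> mD fi; elim: s => [|i s IH].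
  rewrite big_nil; under eq_Rintegral do rewrite big_nil.
  by rewrite Rintegral_cst// mul0r.
rewrite big_cons -IH -RintegralD//; last exact: integrable_sum_fin.
by apply: eq_Rintegral => x _; rewrite big_cons.
Qed.

Lemma ge0_subset_Rintegral (A D : set T) (f : T -> R) :
  measurable A -> measurable D -> A `<=` D -> mu.-integrable D (EFin \o f) ->
  (forall x, D x -> 0 <= f x) ->
  \int[mu]_(x in A) f x <= \int[mu]_(x in D) f x.
Proof.
move=> mA mD AD fi f0; rewrite /Rintegral fine_le//.
- by apply: integrable_fin_num => //; exact: integrableS fi.
- exact: integrable_fin_num.
- apply: ge0_subset_integral => //; first by case/integrableP: fi.
Qed.

End Rintegral_extra.

Section integralmx_theory.
Variables (R : realType) (n : nat).
Local Notation mu := (@lebesgue_measure R).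

Lemma inner_integralmx (D : set (measurableTypeR R)) (F : R -> 'M[R]_n) u v :
  measurable D ->
  (forall i j, mu.-integrable D (EFin \o (fun s => F s i j))) ->
  inner (integralmx D F *m u) v = \int[mu]_(s in D) inner (F s *m u) v.
Proof.
move=> mD Fi; rewrite /inner.
have Zi i j : mu.-integrable D (EFin \o (fun s => F s i j * u j 0)).
  rewrite (_ : _ \o _ = (fun s => (u j 0)%:E * (F s i j)%:E)%E).
    exact: (integrableZl mD (u j 0) (Fi i j)).
  by apply/funext => s /=; rewrite -EFinM mulrC.
have Si i : mu.-integrable D (EFin \o (fun s => (F s *m u) i 0 * v i 0)).
  rewrite (_ : _ \o _ = (fun s => (v i 0)%:E * (\sum_j (F s i j * u j 0))%R%:E)%E).
    by apply: (integrableZl mD (v i 0)); exact: integrable_sum_fin.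
  by apply/funext => s /=; rewrite -EFinM mulrC mxE.
rewrite Rintegral_sum_fin//; apply: eq_bigr => i _.
rewrite mxE mulr_suml.
under [RHS]eq_Rintegral do rewrite mxE mulrC.
rewrite RintegralZl//; last exact: integrable_sum_fin.
rewrite Rintegral_sum_fin// mulr_sumr; apply: eq_bigr => j _.
rewrite mxE mulrC; congr (_ * _).
by under [RHS]eq_Rintegral do rewrite mulrC; rewrite RintegralZl// mulrC.
Qed.

End integralmx_theory.

Section covariance_theory.
Variables (R : realType) (N : nat) (Q B : 'M[R]_N).
Local Notation mu := (@lebesgue_measure R).
Hypotheses (Qsym : Q = Q^T) (Qpsd : psd Q).
Hypothesis Kinv : forall t : R, 0 < t -> Kmx Q B t \in unitmx.
Local Notation cov := (covariance Q B).

Definition cov_integral (t : R) := integralmx `[0, t] cov.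
Local Notation M := cov_integral.

Lemma cvg_expmx_at (A : 'M[R]_N) (t : R) :
  expmx (s *: A) @[s --> t] --> expmx (t *: A).
Proof.
apply: cvg_mx => i j.
have h := @is_derive_expmxl R N N 1%:M A t i j.
have /derivable1_diffP/differentiable_continuous := @ex_derive _ _ _ _ _ _ _ h.
rewrite /prop_for /continuous_at mul1mx => c.
by rewrite (_ : (fun s => _) = fun s => (1%:M *m expmx (s *: A)) i j)//;
  apply/funext => s; rewrite mul1mx.
Qed.

Lemma cvg_covariance (t : R) : cov s @[s --> t] --> cov t.
Proof.
apply: cvg_mulmx; last exact: cvg_expmx_at.
by apply: cvg_mulmx; [exact: cvg_expmx_at | exact: cvg_cst].
Qed.

Lemma continuous_covariance i j : continuous (fun s : R => cov s i j).
Proof. by move=> t; apply: cvg_coord; exact: cvg_covariance. Qed.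

Lemma integrable_covariance t i j :
  mu.-integrable `[0, t] (EFin \o (fun s => cov s i j)).
Proof.
apply: continuous_compact_integrable; first exact: segment_compact.
apply: continuous_subspaceT; exact: continuous_covariance.
Qed.

Lemma covariance_sym s : (cov s)^T = cov s.
Proof.
by rewrite /covariance -trmx_expmx !trmx_mul trmxK -Qsym mulmxA.
Qed.

Lemma inner_covariance s v :
  inner (cov s *m v) v = inner (Q *m (expmx (s *: B^T) *m v)) (expmx (s *: B^T) *m v).
Proof. by rewrite /covariance -!mulmxA inner_mull trmx_expmx. Qed.

Lemma inner_covariance_ge0 s v : 0 <= inner (cov s *m v) v.
Proof. by rewrite inner_covariance; exact: Qpsd. Qed.

Lemma inner_cov_integral t u v :
  inner (M t *m u) v = \int[mu]_(s in `[0, t]) inner (cov s *m u) v.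
Proof. by apply: inner_integralmx => // i j; exact: integrable_covariance. Qed.

Lemma cov_integral_sym t : (M t)^T = M t.
Proof.
apply/matrixP => i j; rewrite !mxE; apply: eq_Rintegral => s _.
by rewrite -[in LHS]covariance_sym mxE.
Qed.

Lemma cov_integralE t : t != 0 -> M t = t *: Kmx Q B t.
Proof. by move=> t0; rewrite /Kmx scalerA divff// scale1r. Qed.

Lemma posdef_cov_integral t : 0 < t -> posdef (M t).
Proof.
move=> t0; apply: psd_unitmx_posdef; first exact: cov_integral_sym.
  move=> v; rewrite inner_cov_integral; apply: Rintegral_ge0 => s _.
  exact: inner_covariance_ge0.
by rewrite cov_integralE ?gt_eqF// unitmxZ ?Kinv// unitfE gt_eqF.
Qed.

Lemma integrable_inner_covariance (D : set (measurableTypeR R)) u v : measurable D ->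
  (forall i j, mu.-integrable D (EFin \o (fun s => cov s i j))) ->
  mu.-integrable D (EFin \o (fun s => inner (cov s *m u) v)).
Proof.
move=> mD ci.
rewrite (_ : _ \o _ = EFin \o (fun s =>
    \sum_(ij : 'I_N * 'I_N) u ij.2 0 * v ij.1 0 * cov s ij.1 ij.2)).
  apply: integrable_sum_fin => // -[i j].
  exact: (integrableZl mD (u j 0 * v i 0) (ci i j)).
apply/funext => s /=; congr EFin; rewrite /inner.
rewrite -(pair_bigA _ (fun i j => u j 0 * v i 0 * cov s i j))/=.
apply: eq_bigr => i _; rewrite mxE mulr_suml; apply: eq_bigr => j _; ring.
Qed.

Lemma cov_integral_le t t' v : t <= t' ->
  inner (M t *m v) v <= inner (M t' *m v) v.
Proof.
move=> tt'; rewrite !inner_cov_integral.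
apply: ge0_subset_Rintegral => //.
- by apply: subset_itvl; rewrite bnd_simp.
- by apply: integrable_inner_covariance => // i j; exact: integrable_covariance.
- by move=> s _; exact: inner_covariance_ge0.
Qed.

Lemma cvg_cov_integral (t : R) : 0 < t -> M s @[s --> t] --> M t.
Proof.
move=> t0; apply: cvg_mx => i j; rewrite mxE.
(* The point t is interior to [0, t + 1], on which the primitive of the covariance is continuous. *)
have h : (0 : R) <= t + 1 by rewrite addr_ge0// ltW.
have := parameterized_integral_continuous h (@integrable_covariance (t + 1) i j).
have h' : 0 < t + 1 by rewrite addr_gt0.
move=> /(continuous_within_itvP _ h')[+ _ _] => /(_ t).
rewrite in_itv/= t0 ltrDl ltr01 => /(_ isT).
rewrite /continuous_at /parameterized_integral.
by under [in X in _ -> X]eq_fun do rewrite mxE.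
Qed.

(** The variance of each coordinate is O(t), which is the origin of the rate sqrt t in
    [Psg_small_time]. *)
Lemma cov_integral_diag_le : exists2 C, 0 <= C &
  forall t i, 0 <= t <= 1 -> M t i i <= C * t.
Proof.
have /choice[C HC] : forall i, exists C, forall s, s \in `[0, 1] -> cov s i i <= C.
  move=> i.
  have [c _ hc] := @EVT_max _ (fun s => cov s i i) 0 1 ler01
     (continuous_subspaceT (@continuous_covariance i i)).
  by exists (cov c i i).
exists (\sum_i `|C i|); first exact: sumr_ge0.
move=> t i /andP[t0 t1]; rewrite mxE.
apply: (@le_trans _ _ (\int[mu]_(s in `[0, t]) `|C i|)).
  apply: le_Rintegral => //; first exact: integrable_covariance.
    apply: continuous_compact_integrable; first exact: segment_compact.
    by apply: continuous_subspaceT => x; exact: cvg_cst.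
  move=> s /=; rewrite in_itv/= => /andP[s0 st].
  by apply: le_trans (ler_norm _); apply: HC; rewrite in_itv/= s0 (le_trans st).
rewrite Rintegral_cst//= lebesgue_measure_itv/= lte_fin.
case: ltP => t0'; last by rewrite mulr0 mulr_ge0// sumr_ge0.
rewrite sube0 ler_wpM2r// (bigD1 i)//= lerDl sumr_ge0//.
Qed.

End covariance_theory.

(** * Growth of det (t K(t)) when B is not stable *)

Section real_imaginary_sums.
Variable (R : realType).
Local Notation Re := (@complex.Re R).
Local Notation Im := (@complex.Im R).

Lemma Re_sum (I : Type) (s : seq I) (F : I -> R[i]) :
  Re (\sum_(i <- s) F i) = \sum_(i <- s) Re (F i).
Proof. by apply: (big_morph Re _ _) => [[? ?] [? ?]|]. Qed.

Lemma Im_sum (I : Type) (s : seq I) (F : I -> R[i]) :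
  Im (\sum_(i <- s) F i) = \sum_(i <- s) Im (F i).
Proof. by apply: (big_morph Im _ _) => [[? ?] [? ?]|]. Qed.

End real_imaginary_sums.

(** * The spectrum of B: finite, nonempty, with an eigenvalue of largest real part *)

Section spectrum_theory.
Variables (R : realType) (N : nat) (B : 'M[R]_N).

Lemma spectrum_finite : exists rs : seq R[i], spectrum B = [set` rs].
Proof.
have [rs Hrs] := closed_field_poly_normal (char_poly (map_mx (real_complex R) B)).
exists rs; apply/seteqP; split=> l /=; rewrite /spectrum/= eigenvalue_root_char Hrs;
  by rewrite rootZ ?root_prod_XsubC// lead_coef_eq0 -size_poly_eq0 size_char_poly.
Qed.

Lemma spectrum_nonempty : (0 < N)%N -> exists l, spectrum B l.
Proof.
move=> N0; have /closed_rootP[l rl] : size (char_poly (map_mx (real_complex R) B)) != 1%N.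
  by rewrite size_char_poly; case: N N0.
by exists l; rewrite /spectrum/= eigenvalue_root_char.
Qed.

Lemma seq_max_Re (rs : seq R[i]) (l : R[i]) : l \in rs ->
  exists2 m, m \in rs & forall r, r \in rs -> complex.Re r <= complex.Re m.
Proof.
elim: rs l => // a rs IH l _.
have [->|[b bm hb]] : rs = [::] \/
    exists2 m, m \in rs & forall r, r \in rs -> complex.Re r <= complex.Re m.
- case: rs IH => [|b rs] IH; [by left|right; apply: (IH b); exact: mem_head].
- by exists a; rewrite ?mem_head// => r; rewrite inE => /eqP ->.
have [ab|ba] := leP (complex.Re a) (complex.Re b).
- by exists b; rewrite ?inE ?bm ?orbT// => r; rewrite inE => /predU1P[->//|/hb].
- exists a; rewrite ?mem_head// => r; rewrite inE => /predU1P[->//|/hb].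
  by move/le_trans; apply; exact: ltW.
Qed.

Lemma max_Re_spectrumP : (0 < N)%N -> exists2 l, spectrum B l &
  max_Re_spectrum B = complex.Re l /\
  forall r, spectrum B r -> complex.Re r <= complex.Re l.
Proof.
move=> N0; have [rs Ers] := spectrum_finite.
have [l0 sl0] := spectrum_nonempty N0.
have l0rs : l0 \in rs by move: sl0; rewrite Ers.
have [m mrs hm] := seq_max_Re l0rs.
have hm' r : spectrum B r -> complex.Re r <= complex.Re m by rewrite Ers; exact: hm.
have sm : spectrum B m by rewrite Ers.
exists m => //; split=> //; apply/eqP; rewrite eq_le; apply/andP; split.
  apply: ge_sup; first by exists (complex.Re m); exists m.
  by move=> _ [r sr <-]; exact: hm'.
apply: ub_le_sup; last by exists m.
by exists (complex.Re m) => _ [r sr <-]; exact: hm'.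
Qed.

End spectrum_theory.

Section growth.
Variables (R : realType) (N : nat) (Q B : 'M[R]_N).
Local Notation mu := (@lebesgue_measure R).
Hypotheses (Qsym : Q = Q^T) (Qpsd : psd Q).
Hypothesis Kinv : forall t : R, 0 < t -> Kmx Q B t \in unitmx.
Local Notation cov := (covariance Q B).
Local Notation M := (cov_integral Q B).

(** [eigenvalue] refers to row eigenvectors w B = l w. Transposed, their real and imaginary parts a
    and b are acted on by B^T, the matrix in the right-hand factor of [covariance]. *)
Lemma eigenvalue_real_imag (l : R[i]) : spectrum B l ->
  exists a b : 'cV[R]_N, [/\ (a != 0) || (b != 0),
    B^T *m a = complex.Re l *: a - complex.Im l *: b &
    B^T *m b = complex.Im l *: a + complex.Re l *: b].
Proof.
move=> /eigenvalueP[w wB w0].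
pose a : 'cV[R]_N := \col_i complex.Re (w 0 i).
pose b : 'cV[R]_N := \col_i complex.Im (w 0 i).
have wE j : \sum_i w 0 i * (B i j)%:C%C = l * w 0 j.
  have /matrixP/(_ 0 j) := wB; rewrite !mxE => <-.
  by apply: eq_bigr => i _; rewrite !mxE.
exists a, b; split.
- apply: contraNT w0; rewrite negb_or !negbK => /andP[/eqP a0 /eqP b0].
  apply/eqP/rowP => i; rewrite mxE.
  move/colP/(_ i): a0; move/colP/(_ i): b0; rewrite !mxE.
  by case: (w 0 i) => x y /= -> ->.
- apply/colP => j; rewrite !mxE.
  have /(congr1 (@complex.Re R)) := wE j; rewrite Re_sum => /esym.
  case: l {wB wE} => lr li; case E : (w 0 j) => [x y] /= E2.
  rewrite E2; apply: eq_bigr => i _; rewrite !mxE.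
  by case: (w 0 i) => c d /=; ring.
- apply/colP => j; rewrite !mxE.
  have /(congr1 (@complex.Im R)) := wE j; rewrite Im_sum => /esym.
  case: l {wB wE} => lr li; case E : (w 0 j) => [x y] /= E2.
  rewrite addrC; rewrite E2; apply: eq_bigr => i _; rewrite !mxE.
  by case: (w 0 i) => c d /=; ring.
Qed.

(** Transposing turns e^{sB^T} x into the row x^T e^{sB}, whose derivative contains x^T B = (B^T
    x)^T. The pair (c, d) covers the real and the imaginary part of an eigenvector at once. *)
Lemma is_derive_row_expmx (x y : 'cV[R]_N) (c d s : R) :
  B^T *m x = c *: x + d *: y ->
  forall i, is_derive s 1 (fun s => (expmx (s *: B^T) *m x) i 0)
    (c * (expmx (s *: B^T) *m x) i 0 + d * (expmx (s *: B^T) *m y) i 0).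
Proof.
move=> Bx i.
have E (z : 'cV[R]_N) u : (expmx (u *: B^T) *m z) i 0 = (z^T *m expmx (u *: B)) 0 i.
  by rewrite -trmx_expmx -[z in LHS]trmxK -trmx_mul mxE.
rewrite (_ : (fun s => _) = (fun s => (x^T *m expmx (s *: B)) 0 i)); last first.
  by apply/funext => u; rewrite E.
rewrite !E.
have := is_derive_expmxl x^T B s 0 i.
rewrite -[B in x^T *m B]trmxK -trmx_mul Bx linearD/= !linearZ/=.
by rewrite mulmxDl -!scalemxAl !mxE.
Qed.

(* Along the real and imaginary parts u, v of e^{sB^T} w, where w is an
   eigenvector, the form <Qu,u> + <Qv,v> is multiplied by e^{2 s Re l}. *)
Lemma cov_integral_growth (l : R[i]) : spectrum B l -> 0 <= complex.Re l ->
  exists a b : 'cV[R]_N, exists2 c, 0 < c &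
   forall t, 0 < t -> c * t <= inner (M t *m a) a + inner (M t *m b) b.
Proof.
move=> sl l0; have [a [b [ab Ba Bb]]] := eigenvalue_real_imag sl.
move: l0 Ba Bb; set al := complex.Re l; set be := complex.Im l => l0 Ba Bb.
pose u s := expmx (s *: B^T) *m a.
pose v s := expmx (s *: B^T) *m b.
pose h s := inner (cov s *m a) a + inner (cov s *m b) b.
have hE : h = \sum_(i < N) \sum_(j < N)
    (fun s => Q i j * (u s j 0 * u s i 0 + v s j 0 * v s i 0)).
  apply/funext => s; rewrite /h !inner_covariance /inner -big_split/= fct_sumE.
  apply: eq_bigr => i _; rewrite fct_sumE !mxE !mulr_suml -big_split/=.
  by apply: eq_bigr => j _; rewrite /u /v; ring.
have du (s : R) i : is_derive s 1 (fun s => u s i 0) (al * u s i 0 - be * v s i 0).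
  by have := @is_derive_row_expmx a b al (- be) s _ i; rewrite scaleNr mulNr; apply.
have dv (s : R) i : is_derive s 1 (fun s => v s i 0) (be * u s i 0 + al * v s i 0).
  have := @is_derive_row_expmx b a al be s _ i; rewrite addrC => h1.
  by rewrite addrC; apply: h1.
have dh (s : R) : is_derive s 1 h (2 * al * h s).
  have dij i j : is_derive s 1 (fun s => Q i j * (u s j 0 * u s i 0 + v s j 0 * v s i 0))
      (2 * al * (Q i j * (u s j 0 * u s i 0 + v s j 0 * v s i 0))).
    have d1 := is_deriveM (du s j) (du s i); have d2 := is_deriveM (dv s j) (dv s i).
    apply: (is_derive_eq (is_deriveZ (Q i j) (is_deriveD d1 d2))).
    by rewrite /GRing.scale/=; ring.
  have := is_derive_sum (fun i => is_derive_sum (dij i)); rewrite -hE.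
  move/is_derive_eq; apply; rewrite hE fct_sumE mulr_sumr; apply: eq_bigr => i _.
  by rewrite fct_sumE mulr_sumr.
(* The equation h' = 2 al h is solved by checking that k has derivative 0. *)
pose k s := h s * expR (- (2 * al) * s).
have dk (s : R) : is_derive s 1 k 0.
  have de := is_derive1_comp (is_derive_expR _)
    (is_deriveZ (- (2 * al)) (is_derive_id s (1 : R))).
  apply: (is_derive_eq (is_deriveM (dh s) de)).
  by rewrite /GRing.scale/=; ring.
have hs s : h s = h 0 * expR (2 * al * s).
  have := is_derive_0_is_cst s 0 dk.
  rewrite /k mulr0 expR0 mulr1 => <-.
  by rewrite -mulrA -expRD mulNr addNr expR0 mulr1.
have ic t x : mu.-integrable `[0, t] (EFin \o (fun s => inner (cov s *m x) x)).
  by apply: integrable_inner_covariance => // i j; exact: integrable_covariance.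
have ih t : mu.-integrable `[0, t] (EFin \o h).
  by apply: (integrableD _ (ic t a) (ic t b)).
have Mh t : 0 < t ->
    inner (M t *m a) a + inner (M t *m b) b = \int[mu]_(s in `[0, t]) h s.
  move=> t0; rewrite !inner_cov_integral -RintegralD//;
  by apply: integrable_inner_covariance => // i j; exact: integrable_covariance.
(* Q is only psd, so h 0 = <Qa,a> + <Qb,b> might vanish a priori. Then h would vanish identically,
   and so would the form of M 1 at both a and b, although one of them is nonzero. *)
have h0 : 0 < h 0.
  rewrite lt_neqAle; apply/andP; split; last first.
    by rewrite addr_ge0// inner_covariance_ge0.
  apply/eqP => h00; have := Mh 1 ltr01.
  under eq_Rintegral do rewrite hs -h00 mul0r.
  rewrite Rintegral_cst// mul0r => /eqP; rewrite gt_eqF//.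
  have [_ M0] := posdef_cov_integral Qsym Qpsd Kinv (@ltr01 R).
  case/orP: ab => [/M0 a0|/M0 b0].
    by rewrite ltr_pwDl// (posdef_ge0 _ (posdef_cov_integral Qsym Qpsd Kinv (@ltr01 R))).
  by rewrite ltr_pwDr// (posdef_ge0 _ (posdef_cov_integral Qsym Qpsd Kinv (@ltr01 R))).
exists a, b, (h 0) => // t t0; rewrite Mh//.
have -> : h 0 * t = \int[mu]_(s in `[0, t]) h 0.
  by rewrite Rintegral_cst//= lebesgue_measure_itv/= lte_fin t0 sube0.
apply: le_Rintegral; [by []| |by apply: ih|].
  apply: continuous_compact_integrable; first exact: segment_compact.
  by apply: continuous_subspaceT => x; exact: cvg_cst.
move=> s /=; rewrite in_itv/= => /andP[s0 _].
rewrite [leRHS]hs; apply: ler_peMr; first exact: ltW.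
by rewrite -[leLHS]expR0 ler_expR !mulr_ge0.
Qed.

(** For t >= 1 the entries of M t are O(det (M t)), hence so are its values at the fixed vectors a
    and b, whose sum grows linearly. *)
Lemma det_cov_integral_growth : (0 < N)%N -> 0 <= max_Re_spectrum B ->
  exists2 c, 0 < c & forall t, 1 <= t -> c * t <= \det (M t).
Proof.
move=> N0; have [l sl [-> _]] := max_Re_spectrumP B N0.
move=> l0; have [a [b [c c0 hc]]] := cov_integral_growth sl l0.
have M1 := posdef_cov_integral Qsym Qpsd Kinv (@ltr01 R).
have [C C0 hC] := posdef_le_det M1.
pose S (x : 'cV[R]_N) := \sum_i \sum_j `|x j 0| * `|x i 0|.
have S0 x : 0 <= S x by apply: sumr_ge0 => i _; apply: sumr_ge0 => j _; rewrite mulr_ge0.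
have bnd t x : 1 <= t -> inner (M t *m x) x <= C * \det (M t) * S x.
  move=> t1; rewrite /inner /S mulr_sumr; apply: ler_sum => i _.
  rewrite mxE mulr_suml mulr_sumr; apply: ler_sum => j _.
  rewrite -mulrA; apply: le_trans (ler_norm _) _; rewrite !normrM.
  rewrite ler_wpM2r ?mulr_ge0// hC//.
    exact: (posdef_cov_integral Qsym Qpsd Kinv (lt_le_trans ltr01 t1)).
  by move=> v; exact: cov_integral_le.
(* The added 1 keeps the denominator of the constant positive. *)
have D0 : 0 < C * (S a + S b) + 1 by rewrite ltr_pwDr// mulr_ge0// addr_ge0.
exists (c / (C * (S a + S b) + 1)); first by rewrite divr_gt0.
move=> t t1; have t0 := lt_le_trans ltr01 t1.
have d0 := posdef_det_gt0 (posdef_cov_integral Qsym Qpsd Kinv t0).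
rewrite mulrAC ler_pdivrMr//; apply: le_trans (hc t t0) _.
apply: le_trans (lerD (bnd t a t1) (bnd t b t1)) _.
rewrite -subr_ge0 (_ : _ - _ = \det (M t)) ?ltW//; ring.
Qed.

End growth.

(** * Exponential decay of e^{tB} when B is stable *)

Section real_imaginary_parts.
Variable (R : realType).
Local Notation Re := (@complex.Re R).
Local Notation Im := (@complex.Im R).

Lemma Re_mulmx m n p (A : 'M[R[i]]_(m, n)) (B : 'M[R[i]]_(n, p)) :
  map_mx Re (A *m B) = map_mx Re A *m map_mx Re B - map_mx Im A *m map_mx Im B.
Proof.
apply/matrixP => i j; rewrite !mxE Re_sum -sumrB; apply: eq_bigr => k _.
by rewrite !mxE; case: (A i k) => a b; case: (B k j) => c d.
Qed.

Lemma Im_mulmx m n p (A : 'M[R[i]]_(m, n)) (B : 'M[R[i]]_(n, p)) :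
  map_mx Im (A *m B) = map_mx Re A *m map_mx Im B + map_mx Im A *m map_mx Re B.
Proof.
apply/matrixP => i j; rewrite !mxE Im_sum -big_split/=; apply: eq_bigr => k _.
by rewrite !mxE; case: (A i k) => a b; case: (B k j) => c d.
Qed.

Lemma Re_real_complex m n (A : 'M[R]_(m, n)) : map_mx Re (map_mx (real_complex R) A) = A.
Proof. by apply/matrixP => i j; rewrite !mxE. Qed.

Lemma Im_real_complex m n (A : 'M[R]_(m, n)) : map_mx Im (map_mx (real_complex R) A) = 0.
Proof. by apply/matrixP => i j; rewrite !mxE. Qed.

(** The Schur form P B P^-1 = T, with T lower triangular, is written with P = P1 + i P2, P^-1 = S1 +
    i S2 and T = T1 + i T2. Of P^-1 P = 1 only the real part is recorded, which suffices to recover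
    e^{sB} from P e^{sB}. *)
Lemma real_triangularization n (B : 'M[R]_n) : (0 < n)%N ->
  exists P1 P2 S1 S2 T1 T2 : 'M[R]_n,
  [/\ S1 *m P1 - S2 *m P2 = 1%:M,
      P1 *m B = T1 *m P1 - T2 *m P2, P2 *m B = T1 *m P2 + T2 *m P1,
      (forall i j : 'I_n, (i < j)%N -> T1 i j = 0 /\ T2 i j = 0) &
      forall i, exists2 l, spectrum B l & T1 i i = Re l].
Proof.
move=> n0; set A := map_mx (real_complex R) B.
have [P /unitarymx_unit Pu] := Schur A n0.
rewrite /= => Ptrig.
pose T := P *m A *m invmx P.
have PT : P *m A = T *m P by rewrite /T mulmxKV.
have Ttrig : is_trig_mx T.
  by have : is_trig_mx (conjmx P A) := Ptrig; rewrite conjumx.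
have Te i : spectrum B (T i i).
  have : eigenvalue T (T i i).
    rewrite eigenvalue_root_char char_poly_trig//; apply/rootP.
    by rewrite horner_prod (bigD1 i)//= hornerXsubC subrr mul0r.
  move=> /eigenvalueP[v vT v0]; apply/eigenvalueP; exists (v *m P).
    by rewrite -mulmxA -/A PT mulmxA vT scalemxAl.
  by apply: contra v0 => /eqP vP; rewrite -(mulmxK Pu v) vP mul0mx.
exists (map_mx Re P), (map_mx Im P), (map_mx Re (invmx P)), (map_mx Im (invmx P)).
exists (map_mx Re T), (map_mx Im T); split.
- rewrite -Re_mulmx mulVmx//; apply/matrixP => i j; rewrite !mxE.
  by case: (i == j).
- by rewrite -Re_mulmx -PT Re_mulmx /A Re_real_complex Im_real_complex mulmx0 subr0.
- by rewrite -Im_mulmx -PT Im_mulmx /A Re_real_complex Im_real_complex mulmx0 add0r.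
- by move=> i j ij; have /is_trig_mxP/(_ i j ij) T0 := Ttrig; split; rewrite mxE T0.
- by move=> i; exists (T i i) => //; rewrite mxE.
Qed.

End real_imaginary_parts.

Section exponential_decay.
Variable R : realType.

(** Gronwall's argument: g e^{mu s} has a nonpositive derivative. *)
Lemma decay_of_derivative_le (g dg : R -> R) (mu : R) :
  (forall s : R, is_derive s 1 g (dg s)) -> (forall s, dg s <= - mu * g s) ->
  forall s, 0 <= s -> g s <= g 0 * expR (- mu * s).
Proof.
move=> Dg hg s s0.
pose k s := g s * expR (mu * s).
pose dk s := (dg s + mu * g s) * expR (mu * s).
have Dk (x : R) : is_derive x 1 k (dk x).
  have de := is_derive1_comp (is_derive_expR _) (is_deriveZ mu (is_derive_id x (1 : R))).
  apply: (is_derive_eq (is_deriveM (Dg x) de)).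
  by rewrite /GRing.scale/= /dk; ring.
have [c _ hc] := @MVT_segment R k dk 0 s s0 (fun x _ => Dk x)
  (derivable_within_continuous (fun x _ => @ex_derive _ _ _ _ _ _ _ (Dk x))).
have : k s <= k 0.
  rewrite -subr_le0 hc subr0 mulr_le0_ge0//.
  rewrite /dk mulr_le0_ge0 ?expR_ge0//.
  by have := hg c; rewrite mulNr; lra.
rewrite /k mulr0 expR0 mulr1 mulNr expRN => h.
by rewrite ler_pdivlMr ?expR_gt0.
Qed.

(** Young's inequality for complex numbers, 2 Re(conj(z1) c z2) <= e |z1|^2 + |c|^2 |z2|^2 / e, with
    z1 = x1 + i y1, z2 = x2 + i y2 and c = a + i b. The difference of the two sides is |e z1 - c
    z2|^2 / e. *)
Lemma triangular_cross_term (x1 y1 x2 y2 a b e : R) : 0 < e ->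
  2 * (x1 * (a * x2 - b * y2) + y1 * (a * y2 + b * x2)) <=
  e * (x1 ^+ 2 + y1 ^+ 2) + (a ^+ 2 + b ^+ 2) / e * (x2 ^+ 2 + y2 ^+ 2).
Proof.
move=> e0; rewrite -subr_ge0.
set p := a * x2 - b * y2; set r := a * y2 + b * x2.
have -> : e * (x1 ^+ 2 + y1 ^+ 2) + (a ^+ 2 + b ^+ 2) / e * (x2 ^+ 2 + y2 ^+ 2) -
    2 * (x1 * p + y1 * r) = ((e * x1 - p) ^+ 2 + (e * y1 - r) ^+ 2) / e.
  by rewrite /p /r; field; rewrite gt_eqF.
by rewrite divr_ge0 ?(ltW e0)// addr_ge0// sqr_ge0.
Qed.

(* The weights de^i make the strictly lower triangular terms a small perturbation. *)
Lemma triangular_lyapunov n (T1 T2 : 'M[R]_n) (mu : R) : 0 < mu ->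
  (forall i j : 'I_n, (i < j)%N -> T1 i j = 0 /\ T2 i j = 0) ->
  (forall i, T1 i i <= - mu) ->
  exists2 de : R, 0 < de <= 1 & forall x y : 'I_n -> R,
    \sum_(i < n) de ^+ i * (2 * (x i * \sum_j (T1 i j * x j - T2 i j * y j) +
                           y i * \sum_j (T1 i j * y j + T2 i j * x j))) <=
    - mu * \sum_(i < n) de ^+ i * (x i ^+ 2 + y i ^+ 2).
Proof.
move=> mu0 Ttrig Td.
(* Row i has at most n cross terms, each costing [e * q i]; their sum stays below mu / 2 times
   [q i]. The added 1 keeps the denominator nonzero when n = 0. *)
pose e := mu / (2 * (n%:R + 1)).
have n1 : 0 < n%:R + 1 :> R by rewrite ltr_wpDl.
have e0 : 0 < e by rewrite divr_gt0// mulr_gt0.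
pose tau := \sum_i \sum_j (T1 i j ^+ 2 + T2 i j ^+ 2).
have t0 i j : 0 <= T1 i j ^+ 2 + T2 i j ^+ 2 by rewrite addr_ge0// sqr_ge0.
have tau0 : 0 <= tau by apply: sumr_ge0 => i _; apply: sumr_ge0.
have taule j : \sum_i (T1 i j ^+ 2 + T2 i j ^+ 2) <= tau.
  rewrite /tau exchange_big/= [leRHS](bigD1 j)//= lerDl.
  by apply: sumr_ge0 => k _; apply: sumr_ge0.
(* With this choice the other half of the cross terms also costs at most mu / 2 times [q i]. Both
   costs together use one of the two mu available on the diagonal. *)
pose de := Num.min 1 (mu / 2 / (tau / e + 1)).
have D0 : 0 < tau / e + 1 by rewrite ltr_wpDl// divr_ge0// ltW.
have de0 : 0 < de by rewrite lt_min ltr01 !divr_gt0.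
have de1 : de <= 1 by rewrite ge_min lexx.
have detau : de * (tau / e) <= mu / 2.
  apply: (@le_trans _ _ (de * (tau / e + 1))); first by rewrite ler_wpM2l ?ltW// ltrDl.
  by rewrite -ler_pdivlMr// ge_min lexx orbT.
exists de => [|x y]; first by rewrite de0.
pose q i := x i ^+ 2 + y i ^+ 2.
have q0 i : 0 <= q i by rewrite addr_ge0// sqr_ge0.
(* Row i contributes its diagonal term, and the cross terms split by AM-GM. *)
pose off (i j : 'I_n) := if (j < i)%N then
  de ^+ i * (e * q i + (T1 i j ^+ 2 + T2 i j ^+ 2) / e * q j) else 0.
have row (i : 'I_n) : de ^+ i * (2 * (x i * \sum_j (T1 i j * x j - T2 i j * y j) +
     y i * \sum_j (T1 i j * y j + T2 i j * x j))) <=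
     de ^+ i * (- (2 * mu) * q i) + \sum_j off i j.
  rewrite mulr_sumr [X in _ + X]mulr_sumr -big_split/= mulr_sumr mulr_sumr.
  rewrite (bigD1 i)//= [X in _ <= _ + X](bigD1 i)//= {1}/off ltnn add0r.
  apply: lerD.
    rewrite ler_wpM2l ?exprn_ge0 ?(ltW de0)//.
    have -> : 2 * (x i * (T1 i i * x i - T2 i i * y i) +
        y i * (T1 i i * y i + T2 i i * x i)) = 2 * T1 i i * q i by rewrite /q; ring.
    by rewrite ler_wpM2r//; have := Td i; lra.
  apply: ler_sum => j ji; rewrite /off; case: ltnP => [lt_ji|le_ij].
    by rewrite ler_wpM2l ?exprn_ge0 ?(ltW de0)// triangular_cross_term.
  have [-> ->] : T1 i j = 0 /\ T2 i j = 0.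
    by apply: Ttrig; rewrite ltn_neqAle le_ij andbT eq_sym.
  by rewrite !mul0r subr0 addr0 !mulr0 addr0 mulr0 mulr0.
apply: (@le_trans _ _ (\sum_(i < n) (de ^+ i * (- (2 * mu) * q i) + \sum_j off i j))).
  by apply: ler_sum => i _; exact: row.
rewrite big_split/=.
have offle : \sum_i \sum_j off i j <= \sum_(i < n) de ^+ i * (mu * q i).
  (* For j < i and de <= 1 one has de^i <= de^j de, so that charging a term of row i to the index j
     gains a factor de. *)
  have offle1 (i j : 'I_n) : off i j <= de ^+ i * (e * q i) +
      de ^+ j * (de * ((T1 i j ^+ 2 + T2 i j ^+ 2) / e * q j)).
    have A0 : 0 <= (T1 i j ^+ 2 + T2 i j ^+ 2) / e * q j.
      by rewrite mulr_ge0// divr_ge0// ltW.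
    rewrite /off; case: ltnP => [lt_ji|_].
      rewrite mulrDr lerD2l [leRHS]mulrA -exprSr ler_wpM2r//.
      by apply: ler_wiXn2l => //; exact: ltW.
    have B1 : 0 <= de ^+ i * (e * q i).
      by apply: mulr_ge0; [exact/exprn_ge0/ltW|apply: mulr_ge0 => //; exact: ltW].
    apply: addr_ge0 => //; apply: mulr_ge0; first exact/exprn_ge0/ltW.
    by apply: mulr_ge0 => //; exact: ltW.
  apply: (@le_trans _ _ (\sum_(i < n) \sum_(j < n) (de ^+ i * (e * q i) +
      de ^+ j * (de * ((T1 i j ^+ 2 + T2 i j ^+ 2) / e * q j))))).
    by apply: ler_sum => i _; apply: ler_sum => j _; exact: offle1.
  under eq_bigr do rewrite big_split/=.
  rewrite big_split/= [X in _ + X]exchange_big/= -big_split/=; apply: ler_sum => i _.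
  have -> : \sum_(j < n) de ^+ i * (e * q i) + \sum_(j < n)
      de ^+ i * (de * ((T1 j i ^+ 2 + T2 j i ^+ 2) / e * q i)) =
    de ^+ i * (e * q i * n%:R + de * ((\sum_j (T1 j i ^+ 2 + T2 j i ^+ 2)) / e * q i)).
    rewrite [RHS]mulrDr; congr (_ + _).
      by rewrite sumr_const card_ord -[LHS]mulr_natr; ring.
    by rewrite !mulr_suml !mulr_sumr.
  rewrite ler_wpM2l ?exprn_ge0 ?(ltW de0)//.
  have h1 : e * q i * n%:R <= mu / 2 * q i.
    rewrite mulrAC ler_wpM2r// /e.
    have -> : mu / (2 * (n%:R + 1)) * n%:R = mu / 2 * (n%:R / (n%:R + 1)).
      by field; rewrite gt_eqF.
    by rewrite ler_piMr ?divr_ge0 ?(ltW mu0)// ler_pdivrMr// mul1r lerDl.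
  have h2 : de * ((\sum_j (T1 j i ^+ 2 + T2 j i ^+ 2)) / e * q i) <= mu / 2 * q i.
    rewrite mulrA ler_wpM2r//; apply: le_trans detau.
    by rewrite ler_wpM2l ?(ltW de0)// ler_wpM2r ?invr_ge0 ?(ltW e0)//.
  apply: le_trans (lerD h1 h2) _.
  by rewrite -mulrDl -splitr.
rewrite mulr_sumr.
apply: le_trans (lerD (lexx _) offle) _.
rewrite -big_split/=; apply: ler_sum => i _; rewrite -/(q i) le_eqVlt.
by apply/orP; left; apply/eqP; ring.
Qed.

End exponential_decay.

Section Rintegral_dominated.
Context d (T : measurableType d) (R : realType) (mu : {measure set T -> \bar R}).

Lemma cvg_Rintegral_dominated (D : set T) (f_ : nat -> T -> R) (f g : T -> R) :
  measurable D -> (forall n, measurable_fun D (f_ n)) ->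
  (forall x, D x -> f_ n x @[n --> \oo] --> f x) ->
  mu.-integrable D (EFin \o g) ->
  (forall n x, D x -> `|f_ n x| <= g x) ->
  \int[mu]_(x in D) f_ n x @[n --> \oo] --> \int[mu]_(x in D) f x.
Proof.
move=> mD mf ff ig fg.
have ff' x : D x -> (EFin \o f_ n) x @[n --> \oo] --> (EFin \o f) x.
  by move=> Dx; apply: cvg_EFin; [exact: nearW|exact: ff].
have mf' n : measurable_fun D (EFin \o f_ n) by exact/measurable_EFinP.
have [||fi _ h] := @dominated_convergence _ _ _ mu D mD (fun n => EFin \o f_ n)
  (EFin \o f) (EFin \o g) mf'
  (emeasurable_fun_cvg (fun n => EFin \o f_ n) (EFin \o f) mf' ff') _ ig.
- by apply: aeW => x Dx; exact: ff'.
- by apply: aeW => x n Dx; rewrite lee_fin fg.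
by apply: fine_cvg; rewrite fineK//; exact: integrable_fin_num.
Qed.

End Rintegral_dominated.

Section stable.
Variables (R : realType) (N : nat) (B : 'M[R]_N).
Local Notation mu := (@lebesgue_measure R).
Hypotheses (N0 : (0 < N)%N) (stable : max_Re_spectrum B < 0).

(** Each column z of P e^{sB} solves z' = T z, so the weighted energy of [triangular_lyapunov]
    decays like e^{-nu s}. Multiplying by P^-1 brings the estimate back to e^{sB}. *)
Lemma expmx_decay : exists C om : R, [/\ 0 <= C, 0 < om &
  forall (s : R) i j, 0 <= s -> `|expmx (s *: B) i j| <= C * expR (- om * s)].
Proof.
have [l _ [El lmax]] := max_Re_spectrumP B N0.
have [P1 [P2 [S1 [S2 [T1 [T2 [SP PB1 PB2 Ttrig Td]]]]]]] := real_triangularization B N0.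
pose nu := - complex.Re l.
have nu0 : 0 < nu by rewrite oppr_gt0 -El.
have Td' i : T1 i i <= - nu.
  by have [r sr ->] := Td i; rewrite opprK lmax.
have [de /andP[de0 de1] lyap] := triangular_lyapunov nu0 Ttrig Td'.
pose x (c : 'I_N) s i := (P1 *m expmx (s *: B)) i c.
pose y (c : 'I_N) s i := (P2 *m expmx (s *: B)) i c.
pose g c s := \sum_(i < N) de ^+ i * (x c s i ^+ 2 + y c s i ^+ 2).
pose ex c s i := \sum_j (T1 i j * x c s j - T2 i j * y c s j).
pose ey c s i := \sum_j (T1 i j * y c s j + T2 i j * x c s j).
pose dg c s := \sum_(i < N) de ^+ i * (2 * (x c s i * ex c s i + y c s i * ey c s i)).
have dx c (s : R) i : is_derive s 1 (fun s => x c s i) (ex c s i).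
  have := is_derive_expmxl P1 B s i c.
  by rewrite PB1 mulmxBl -!mulmxA !mxE -sumrB.
have dy c (s : R) i : is_derive s 1 (fun s => y c s i) (ey c s i).
  have := is_derive_expmxl P2 B s i c.
  by rewrite PB2 mulmxDl -!mulmxA !mxE -big_split.
have dgg c (s : R) : is_derive s 1 (g c) (dg c s).
  have di (i : 'I_N) : is_derive s 1 (fun s => de ^+ i * (x c s i ^+ 2 + y c s i ^+ 2))
      (de ^+ i * (2 * (x c s i * ex c s i + y c s i * ey c s i))).
    have d1 := is_deriveM (dx c s i) (dx c s i).
    have d2 := is_deriveM (dy c s i) (dy c s i).
    apply: (is_derive_eq (is_deriveZ (de ^+ i) (is_deriveD d1 d2))).
    by rewrite /GRing.scale/=; ring.
  have := is_derive_sum di; rewrite (_ : \sum_(i < N) _ = g c)//.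
  by apply/funext => u; rewrite fct_sumE.
have gdecay c s : 0 <= s -> g c s <= g c 0 * expR (- nu * s).
  by apply: (decay_of_derivative_le (dgg c)) => u; exact: lyap.
have deN0 : 0 < de ^+ N by rewrite exprn_gt0.
(* The indices are below N and de <= 1, so de^N bounds every weight from below. *)
have xyg c s i : x c s i ^+ 2 + y c s i ^+ 2 <= g c s / de ^+ N.
  rewrite ler_pdivlMr// mulrC.
  apply: (@le_trans _ _ (de ^+ i * (x c s i ^+ 2 + y c s i ^+ 2))).
    rewrite ler_wpM2r ?addr_ge0 ?sqr_ge0//.
    by apply: ler_wiXn2l => //; [exact: ltW|exact: ltnW].
  rewrite /g (bigD1 i)//= lerDl; apply: sumr_ge0 => k _.
  by rewrite mulr_ge0 ?exprn_ge0 ?(ltW de0)// addr_ge0// sqr_ge0.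
have g0 c s : 0 <= g c s.
  by apply: sumr_ge0 => k _; rewrite mulr_ge0 ?exprn_ge0 ?(ltW de0)// addr_ge0// sqr_ge0.
pose G := \sum_c g c 0.
have gG c : g c 0 <= G by rewrite /G (bigD1 c)//= lerDl sumr_ge0.
have G0 : 0 <= G by exact: sumr_ge0.
(* The energy is quadratic in the entries, hence half of its rate. *)
pose om := nu / 2.
have om0 : 0 < om by rewrite divr_gt0.
pose b s := Num.sqrt (G / de ^+ N) * expR (- om * s).
have b0 s : 0 <= b s by rewrite mulr_ge0 ?expR_ge0.
have bnd c s i z : 0 <= s -> z ^+ 2 <= x c s i ^+ 2 + y c s i ^+ 2 -> `|z| <= b s.
  move=> s0 hz; rewrite -(@ler_pXn2r _ 2)// ?nnegrE//.
  rewrite real_normK ?num_real//; apply: (le_trans hz); apply: le_trans (xyg c s i) _.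
  rewrite exprMn sqr_sqrtr ?divr_ge0 ?(ltW deN0)//.
  rewrite -expRM_natl.
  have -> : 2%:R * (- om * s) = - nu * s by rewrite /om; field.
  rewrite mulrAC ler_wpM2r ?invr_ge0 ?(ltW deN0)//.
  by apply: le_trans (gdecay c s s0) _; rewrite ler_wpM2r ?expR_ge0.
exists ((mxsum S1 + mxsum S2) * Num.sqrt (G / de ^+ N)), om; split => //.
  by rewrite mulr_ge0 ?addr_ge0 ?mxsum_ge0.
move=> s i j s0; rewrite -mulrA -/(b s).
have -> : expmx (s *: B) = S1 *m (P1 *m expmx (s *: B)) - S2 *m (P2 *m expmx (s *: B)).
  by rewrite !mulmxA -mulmxBl SP mul1mx.
rewrite mulrDl mxE [X in _ + X]mxE; apply: le_trans (ler_normB _ _) _; apply: lerD.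
- by apply: mulmx_entry_le => // k c; apply: (bnd c s k) => //; rewrite lerDl sqr_ge0.
- by apply: mulmx_entry_le => // k c; apply: (bnd c s k) => //; rewrite lerDr sqr_ge0.
Qed.
End stable.

(** * Convergence of t K(t) to K_oo in the stable case *)

Section stable_covariance.
Variables (R : realType) (N : nat) (Q B : 'M[R]_N).
Local Notation mu := (@lebesgue_measure R).
Hypotheses (N0 : (0 < N)%N) (stable : max_Re_spectrum B < 0).
Hypotheses (Qsym : Q = Q^T) (Qpsd : psd Q).
Hypothesis Kinv : forall t : R, 0 < t -> Kmx Q B t \in unitmx.
Local Notation cov := (covariance Q B).
Local Notation M := (cov_integral Q B).

Lemma integrable_expR_decay (om : R) : 0 < om ->
  mu.-integrable `[0, +oo[ (EFin \o (fun s => expR (- om * s))).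
Proof.
move=> om0.
have mI : measurable (`[0, +oo[%classic : set (measurableTypeR R)).
  exact: measurable_itv.
have h := integrableS measurableT mI (@subsetT _ _) (integrable_exponential_pdf om0).
have := integrableZl mI om^-1 h.
apply: eq_integrable => // s; rewrite inE/= in_itv/= andbT => s0.
by rewrite exponential_pdfE//= -EFinM mulrA mulVf ?mul1r// gt_eqF.
Qed.

Lemma covariance_decay : exists C om : R, [/\ 0 <= C, 0 < om &
  forall (s : R) i j, 0 <= s -> `|cov s i j| <= C * expR (- om * s)].
Proof.
have [C [om [C0 om0 hC]]] := expmx_decay N0 stable.
exists (mxsum (const_mx C : 'M[R]_N) * (mxsum Q * C)), om; split=> //.
  by rewrite !mulr_ge0 ?mxsum_ge0.
move=> s i j s0; rewrite /covariance -mulmxA.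
(* Both exponential factors of the covariance decay. One of them is merely bounded, the other one
   supplies the rate. *)
have e1 : expR (- om * s) <= 1.
  by rewrite -[leRHS]expR0 ler_expR mulNr oppr_le0 mulr_ge0// ltW.
have e0 := expR_ge0 (- om * s).
have hT k l : `|expmx (s *: B^T) k l| <= C * expR (- om * s).
  by rewrite -trmx_expmx mxE hC.
have h2 k l : `|(Q *m expmx (s *: B^T)) k l| <= mxsum Q * (C * expR (- om * s)).
  by apply: mulmx_entry_le => //; rewrite mulr_ge0.
have Ce0 : 0 <= C * expR (- om * s) by rewrite mulr_ge0.
have := @mulmx_entry_le _ _ _ _ (expmx (s *: B)) _ _ i j h2 (mulr_ge0 (mxsum_ge0 _) Ce0).
move=> /le_trans; apply.
rewrite -!mulrA ler_wpM2r ?mulr_ge0 ?mxsum_ge0//.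
rewrite /mxsum; apply: ler_sum => k _; apply: ler_sum => l _.
rewrite mxE (ger0_norm C0); apply: le_trans (hC _ _ _ s0) _.
by rewrite ler_piMr.
Qed.

Lemma integrable_covariancey i j :
  mu.-integrable `[0, +oo[ (EFin \o (fun s => cov s i j)).
Proof.
have [C [om [C0 om0 hC]]] := covariance_decay.
have mI : measurable (`[0, +oo[%classic : set (measurableTypeR R)).
  exact: measurable_itv.
apply: (le_integrable mI _ _ (integrableZl mI C (integrable_expR_decay om0))).
  apply/measurable_EFinP; apply: measurable_funTS.
  by apply: continuous_measurable_fun; exact: continuous_covariance.
move=> s /=; rewrite in_itv/= andbT => s0.
by rewrite lee_fin [leRHS]ger0_norm ?hC// mulr_ge0// expR_ge0.
Qed.

Lemma cvg_cov_integraly (u : nat -> R) : u n @[n --> \oo] --> +oo ->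
  M (u n) @[n --> \oo] --> Kinfty Q B.
Proof.
move=> uoo; apply: cvg_mx => i j; rewrite mxE.
(* Cutting the integrand off at u n puts all the integrals on the fixed domain [0, oo[, where |cov|
   dominates. *)
pose f n := (fun s => cov s i j) \_ [set` `]-oo, u n]].
have mc : measurable_fun setT (fun s => cov s i j).
  by apply: continuous_measurable_fun; exact: continuous_covariance.
rewrite (_ : (fun n => _) = fun n => \int[mu]_(s in `[0, +oo[) f n s); last first.
  apply/funext => n; rewrite mxE -Rintegral_mkcondr; congr Rintegral.
  by apply/seteqP; split=> s /=; rewrite !in_itv/= andbT => /andP.
apply: (@cvg_Rintegral_dominated _ _ R mu `[0, +oo[%classic f (fun s => cov s i j)
  (fun s => `|cov s i j|)) => //.
- by move=> n; apply/measurable_restrict => //; apply: measurable_funTS.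
- move=> s _; apply: cvg_near_cst; near=> n.
  rewrite /f patchE ifT// inE/= in_itv/=.
  by near: n; move/cvgryPge : uoo; exact.
- exact: integrable_norm (integrable_covariancey i j).
- by move=> n s _; rewrite /f patchE; case: ifP => // _; rewrite normr0.
Unshelve. all: by end_near. Qed.

Lemma cvg_expmxy (u : nat -> R) : u n @[n --> \oo] --> +oo ->
  expmx (u n *: B) @[n --> \oo] --> (0 : 'M[R]_N).
Proof.
move=> uoo; apply: cvg_mx => i j; rewrite mxE.
have [C [om [C0 om0 hC]]] := expmx_decay N0 stable.
apply/cvgr0Pnorm_lt => e e0.
have : expR (- om * x) @[x --> +oo] --> (0 : R).
  have h : om * x @[x --> +oo] --> +oo.
    by under eq_fun do rewrite mulrC; apply: gt0_cvgMly.
  have := cvg_comp (fun x => om * x) (fun x => expR (- x)) h (@cvgr_expR R).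
  by apply: cvg_trans; apply: near_eq_cvg; near=> x; rewrite /= mulNr.
move=> /(cvg_comp u (fun x => expR (- om * x)) uoo)/cvgr0Pnorm_lt.
have C1 : 0 < e / (C + 1) by rewrite divr_gt0// ltr_wpDl.
move=> /(_ _ C1) h.
near=> n.
have un0 : 0 <= u n by near: n; move/cvgryPge : uoo; exact.
apply: le_lt_trans (hC _ i j un0) _.
have : `|expR (- om * u n)| < e / (C + 1) by near: n; exact: h.
rewrite (ger0_norm (expR_ge0 _)) ltr_pdivlMr ?ltr_wpDl//; apply: le_lt_trans.
by rewrite mulrC ler_wpM2l ?expR_ge0// lerDl.
Unshelve. all: by end_near. Qed.

Lemma Kinfty_sym : (Kinfty Q B)^T = Kinfty Q B.
Proof.
apply/matrixP => i j; rewrite !mxE; apply: eq_Rintegral => s _.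
by rewrite -[in LHS](covariance_sym B Qsym) mxE.
Qed.

(** The covariance is psd at every time, so K_oo dominates M 1. *)
Lemma posdef_Kinfty : posdef (Kinfty Q B).
Proof.
apply: (posdefD (posdef_cov_integral Qsym Qpsd Kinv (@ltr01 R)) Kinfty_sym) => v.
rewrite inner_cov_integral inner_integralmx//; last exact: integrable_covariancey.
apply: ge0_subset_Rintegral => //.
- by apply: subset_itvl; rewrite bnd_simp.
- by apply: integrable_inner_covariance => //; exact: integrable_covariancey.
- by move=> s _; exact: inner_covariance_ge0.
Qed.

End stable_covariance.

(** * Gaussian averages *)

Section gaussian_average.
Variables (R : realType) (N : nat).
Local Notation RT := (measurableTypeR R).
Local Notation lebN := (@lebesgue_tuple R N).
Implicit Types (S : 'M[R]_N) (m X Y : 'cV[R]_N).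

Definition gauss_const S : R := (4 * pi) `^ (- (N%:R / 2)) / Num.sqrt (\det S).

(** The normal density with mean m and covariance 2 S, because of the factor 1/4 in the exponent. *)
Definition gauss_density S m Y : R :=
  gauss_const S * expR (- (inner (invmx S *m (Y - m)) (Y - m) / 4)).

Definition gauss_avg S m (f : 'cV[R]_N -> R) : R :=
  integralRn (fun Y => gauss_density S m Y * f Y).

Lemma gauss_const_ge0 S : 0 <= gauss_const S.
Proof. by rewrite divr_ge0 ?powR_ge0// sqrtr_ge0. Qed.

Lemma gauss_density_ge0 S m Y : 0 <= gauss_density S m Y.
Proof. by rewrite mulr_ge0 ?gauss_const_ge0// expR_ge0. Qed.

Lemma gauss_density_le S m Y : posdef S -> gauss_density S m Y <= gauss_const S.
Proof.
move=> Sp; rewrite ler_piMr ?gauss_const_ge0// -[leRHS]expR0 ler_expR oppr_le0.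
by rewrite divr_ge0//; exact/posdef_ge0/posdef_invmx.
Qed.

Lemma measurable_gauss_density S m :
  measurable_fun setT (fun y : N.-tuple RT => gauss_density S m (vec y)).
Proof.
apply: measurable_funM => //; apply: measurableT_comp => //.
apply: measurableT_comp => //; apply: measurable_funM => //.
exact: measurable_inner_vec.
Qed.

Lemma integral_gauss_density S m : posdef S ->
  (\int[lebN]_y (gauss_density S m (vec y))%:E = 1)%E.
Proof.
move=> Sp; have Ip := posdef_invmx Sp.
under eq_integral do rewrite EFinM.
rewrite ge0_integralZl//=; last 2 first.
- apply/measurable_EFinP; apply: measurableT_comp => //.
  apply: measurableT_comp => //; apply: measurable_funM => //.
  exact: measurable_inner_vec.
- by rewrite lee_fin gauss_const_ge0.
rewrite integral_gauss// -EFinM; congr EFin.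
have d0 := posdef_det_gt0 Sp.
rewrite /gauss_const det_inv sqrtrV ?ltW// invrK mulrACA mulrC.
rewrite mulVf ?mul1r; last by rewrite gt_eqF// sqrtr_gt0.
rewrite -powRD ?addNr ?powRr0//.
by apply/implyP => _; rewrite gt_eqF// mulr_gt0// pi_gt0.
Qed.

Lemma integrable_gauss_density S m : posdef S ->
  lebN.-integrable setT (fun y => (gauss_density S m (vec y))%:E).
Proof.
move=> Sp; apply/integrableP; split.
  by apply/measurable_EFinP; exact: measurable_gauss_density.
under eq_integral do rewrite /= (ger0_norm (gauss_density_ge0 _ _ _)).
by rewrite integral_gauss_density// ltry.
Qed.

Lemma measurable_gauss_density_mul S m (f : 'cV[R]_N -> R) : continuous f ->
  measurable_fun setT (fun y : N.-tuple RT => gauss_density S m (vec y) * f (vec y)).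
Proof.
move=> cf; apply: measurable_funM; first exact: measurable_gauss_density.
exact: measurable_vec_continuous.
Qed.

Lemma integrable_gauss_density_mul S m (f : 'cV[R]_N -> R) C : posdef S ->
  continuous f -> (forall x, `|f x| <= C) ->
  lebN.-integrable setT (fun y => (gauss_density S m (vec y) * f (vec y))%:E).
Proof.
move=> Sp cf fC.
apply: (le_integrable measurableT _ _
  (integrableZl measurableT C (integrable_gauss_density m Sp))).
  by apply/measurable_EFinP; exact: measurable_gauss_density_mul.
move=> y _ /=; rewrite lee_fin normrM [leRHS]normrM (ger0_norm (gauss_density_ge0 _ _
  _)) mulrC.
rewrite ler_wpM2r ?gauss_density_ge0//.
by apply: le_trans (fC _) _; exact: ler_norm.
Qed.

(** The density is replaced by its maximum [gauss_const S]. In the unstable case this maximum tends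
    to 0 along S = M t. *)
Lemma gauss_avg_le S m (f : 'cV[R]_N -> R) : posdef S -> schwartz f ->
  `|gauss_avg S m f| <= gauss_const S * integralRn (fun Y => `|f Y|).
Proof.
move=> Sp sf; have [C _ fC] := schwartz_bounded sf.
have cf := schwartz_continuous sf.
have fi := schwartz_integrable sf.
have gfi := integrable_gauss_density_mul m Sp cf fC.
apply: le_trans (le_normr_Rintegral measurableT gfi) _.
rewrite /integralRn -RintegralZl//; last exact: (integrable_norm fi).
apply: le_Rintegral => //.
- exact: (integrable_norm gfi).
- exact: (integrableZl measurableT (gauss_const S) (integrable_norm fi)).
- move=> y _; rewrite normrM (ger0_norm (gauss_density_ge0 _ _ _)).
  by rewrite ler_wpM2r// gauss_density_le.
Qed.

(** Dominated convergence. The densities are bounded uniformly in n by their maxima, and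
    integrability comes from f. *)
Lemma cvg_gauss_avg (S_ : nat -> 'M[R]_N) S (m_ : nat -> 'cV[R]_N) m
    (f : 'cV[R]_N -> R) : schwartz f -> posdef S -> (forall n, posdef (S_ n)) ->
  S_ n @[n --> \oo] --> S -> m_ n @[n --> \oo] --> m ->
  gauss_avg (S_ n) (m_ n) f @[n --> \oo] --> gauss_avg S m f.
Proof.
move=> sf Sp Snp SnS mnm.
have cc : gauss_const (S_ n) @[n --> \oo] --> gauss_const S.
  apply: cvgM; first exact: cvg_cst.
  apply: cvgV; first by rewrite gt_eqF// sqrtr_gt0 posdef_det_gt0.
  apply: (cvg_comp (fun n => \det (S_ n)) Num.sqrt (cvg_det SnS)).
  exact: sqrt_continuous.
(* A convergent sequence is bounded by every number above some D, for instance by D + 1. *)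
have [D [_ hD]] := cvg_seq_bounded (cvgP _ cc).
have {}hD n : gauss_const (S_ n) <= D + 1.
  by apply: le_trans (ler_norm _) _; apply: (hD (D + 1)) => //; rewrite ltrDl.
apply: (@cvg_Rintegral_dominated _ _ _ _ _ _ _ (fun y => (D + 1) * `|f (vec y)|)) => //.
- by move=> n; apply: measurable_gauss_density_mul; exact: schwartz_continuous.
- move=> y _; apply: cvgM; last exact: cvg_cst.
  apply: cvgM => //.
  have cI : inner (invmx (S_ n) *m (vec y - m_ n)) (vec y - m_ n) @[n --> \oo] -->
      inner (invmx S *m (vec y - m)) (vec y - m).
    have cm : vec y - m_ n @[n --> \oo] --> vec y - m.
      by apply: cvgB => //; exact: cvg_cst.
    apply: cvg_inner => //; apply: cvg_mulmx => //.
    apply: cvg_invmx => //; first exact: posdef_unitmx.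
    by apply: nearW => n; exact: posdef_unitmx.
  have h : - (inner (invmx (S_ n) *m (vec y - m_ n)) (vec y - m_ n) / 4) @[n --> \oo] -->
      - (inner (invmx S *m (vec y - m)) (vec y - m) / 4).
    by apply: cvgN; apply: (cvgM cI); exact: cvg_cst.
  have hh := cvg_comp _ (@expR R) h (@continuous_expR R _).
  exact: hh.
- exact: (integrableZl measurableT (D + 1) (integrable_norm (schwartz_integrable sf))).
- move=> n y _; rewrite normrM (ger0_norm (gauss_density_ge0 _ _ _)).
  by rewrite ler_wpM2r//; apply: le_trans (hD n); exact: gauss_density_le.
Qed.

(* Completing the square: tilting by exp <a, Y - m> translates the Gaussian. *)
Lemma gauss_density_tilt S m a Y : posdef S ->
  gauss_density S m Y * expR (inner a (Y - m)) =
  expR (inner (S *m a) a) * gauss_density S (m + 2 *: (S *m a)) Y.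
Proof.
move=> Sp; have Su := posdef_unitmx Sp; have [IT _] := posdef_invmx Sp.
rewrite /gauss_density -mulrA -expRD mulrCA -expRD; congr (_ * expR _).
rewrite opprD addrA; move: (Y - m) => Z.
have ISa : invmx S *m (S *m a) = a by rewrite mulKmx.
rewrite mulmxBr -scalemxAr ISa !innerE (inner_sym Z (S *m a) IT) ISa.
by rewrite [inner a (S *m a)]innerC; field.
Qed.

(** With z = (y_i - m_i) / h, the bound |z| <= e^z + e^{-z} reduces the moment to two exponential
    integrals, which the tilting identity evaluates. The scale h is left free; it will be sqrt t. *)
Lemma gauss_first_moment S m h i : posdef S -> 0 < h ->
  (\int[lebN]_y (gauss_density S m (vec y) * `|vec y i 0 - m i 0|)%:E <=
   (2 * h * expR (S i i / h ^+ 2))%:E)%E.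
Proof.
move=> Sp h0.
have absle (x : R) : `|x| <= h * (expR (h^-1 * x) + expR (- h^-1 * x)).
  rewrite -ler_pdivrMl// -{1}(gtr0_norm (_ : 0 < h^-1)) ?invr_gt0// -normrM.
  set z := h^-1 * x; rewrite mulNr -/z.
  have e1 := expR_ge1Dx z; have e2 := expR_ge1Dx (- z).
  have p1 := expR_ge0 z; have p2 := expR_ge0 (- z).
  by rewrite ler_norml; apply/andP; split; lra.
pose a s : 'cV[R]_N := s *: delta_mx i 0.
have ia s Z : inner (a s) Z = s * Z i 0.
  rewrite /a innerZl; congr (_ * _); rewrite /inner (bigD1 i)//= big1 ?addr0.
    by rewrite !mxE !eqxx mul1r.
  by move=> k /negPf ki; rewrite mxE ki mul0r.
have Sa s : inner (S *m a s) (a s) = s ^+ 2 * S i i.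
  by rewrite /a -scalemxAr !innerE inner_delta mulrA expr2.
have tilt s :
    (\int[lebN]_y (gauss_density S m (vec y) * expR (s * (vec y i 0 - m i 0)))%:E =
     (expR (s ^+ 2 * S i i))%:E)%E.
  under eq_integral => y _.
    have -> : s * (vec y i 0 - m i 0) = inner (a s) (vec y - m) by rewrite ia !mxE.
    rewrite gauss_density_tilt// Sa EFinM.
    over.
  rewrite ge0_integralZl//=.
  - by rewrite integral_gauss_density// mule1.
  - by apply/measurable_EFinP; exact: measurable_gauss_density.
  - by move=> y _; rewrite lee_fin gauss_density_ge0.
have mg s : measurable_fun setT (fun y : N.-tuple RT =>
    gauss_density S m (vec y) * expR (s * (vec y i 0 - m i 0))).
  apply: measurable_funM; first exact: measurable_gauss_density.
  apply: measurableT_comp => //; apply: measurable_funM => //.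
  by apply: measurable_funB => //; exact: measurable_vec.
apply: (@le_trans _ _ (\int[lebN]_y (h%:E *
   ((gauss_density S m (vec y) * expR (h^-1 * (vec y i 0 - m i 0)))%:E +
    (gauss_density S m (vec y) * expR (- h^-1 * (vec y i 0 - m i 0)))%:E)))%E).
  apply: ge0_le_integral => //.
  - by move=> y _; rewrite lee_fin mulr_ge0 ?gauss_density_ge0.
  - apply/measurable_EFinP; apply: measurable_funM; first exact: measurable_gauss_density.
    by apply: measurableT_comp => //; apply: measurable_funB => //; exact: measurable_vec.
  - apply: measurable_funeM; apply: emeasurable_funD; exact/measurable_EFinP.
  - move=> y _; rewrite -EFinD -EFinM lee_fin -mulrDr mulrCA.
    by rewrite ler_wpM2l ?gauss_density_ge0.
rewrite ge0_integralZl//=; last 3 first.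
- by apply: emeasurable_funD; exact/measurable_EFinP.
- by move=> y _; rewrite adde_ge0// lee_fin mulr_ge0 ?gauss_density_ge0 ?expR_ge0.
- by rewrite lee_fin ltW.
rewrite ge0_integralD//=; last 4 first.
- by move=> y _; rewrite lee_fin mulr_ge0 ?gauss_density_ge0 ?expR_ge0.
- exact/measurable_EFinP.
- by move=> y _; rewrite lee_fin mulr_ge0 ?gauss_density_ge0 ?expR_ge0.
- exact/measurable_EFinP.
rewrite !tilt sqrrN -EFinD -EFinM lee_fin exprVn [_ / h ^+ 2]mulrC.
by rewrite le_eqVlt; apply/orP; left; apply/eqP; ring.
Qed.

End gaussian_average.

(** * Schwartz functions are Lipschitz *)

Section schwartz_lipschitz.
Variables (R : realType) (n : nat).
Implicit Types (f : 'cV[R]_n -> R) (X Y h : 'cV[R]_n).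

Lemma is_derive_line f X h (t : R) : differentiable f (X + t *: h) ->
  is_derive t 1 (fun s : R => f (X + s *: h)) ('d f (X + t *: h) h).
Proof.
move=> df.
have E : (fun k : R => k^-1 *:
      (((fun s : R => f (X + s *: h)) \o shift t) (k *: 1) - f (X + t *: h))) =
    (fun k : R => k^-1 *: ((f \o shift (X + t *: h)) (k *: h) - f (X + t *: h))).
  apply/funext => k /=; congr (_ *: (f _ - _)).
  have -> : k *: (1 : R) = k by exact: mulr1.
  by rewrite scalerDl addrCA.
apply: DeriveDef.
  by rewrite /derivable E; exact: diff_derivable.
by rewrite /derive E -/(derive _ _ _) deriveE.
Qed.

Lemma diff_sum_partial f X h : differentiable f X ->
  'd f X h = \sum_i h i 0 * partial i f X.
Proof.
move=> df; rewrite {1}(matrix_sum_delta h) linear_sum/=; apply: eq_bigr => i _.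
by rewrite big_ord1 linearZ/= /partial deriveE.
Qed.

(** Mean value theorem along the segment from X to Y, the first partial derivatives being bounded.
    The sum of coordinate differences is chosen to fit the coordinatewise moment bound. *)
Lemma schwartz_lipschitz f : schwartz f ->
  exists2 L, 0 <= L & forall X Y, `|f Y - f X| <= L * \sum_i `|Y i 0 - X i 0|.
Proof.
move=> [df bf].
have /choice[C HC] : forall i, exists C : R, forall X, `|partial i f X| <= C.
  move=> i; have [C HC] := bf (fun=> 0%N) [:: i]; exists C => X.
  by apply: le_trans (HC X); rewrite big1 ?mul1r// => k _; exact: expr0.
have C0 i : 0 <= C i by apply: le_trans (HC i 0); exact: normr_ge0.
exists (\sum_i C i); first exact: sumr_ge0.
move=> X Y; pose h := Y - X.
have D (t : R) := is_derive_line (df [::] (X + t *: h)).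
have [c _] := @MVT_segment R _ _ 0 1 ler01 (fun x _ => D x)
  (derivable_within_continuous (fun x _ => @ex_derive _ _ _ _ _ _ _ (D x))).
have XhY : X + h = Y by rewrite addrC subrK.
rewrite scale1r XhY scale0r addr0 subr0 mulr1 /= => ->.
rewrite diff_sum_partial; last exact: (df [::]).
apply: le_trans (ler_norm_sum _ _ _) _; rewrite mulr_sumr; apply: ler_sum => i _.
rewrite normrM !mxE mulrC ler_wpM2r//; apply: le_trans (HC i _) _.
by rewrite (bigD1 i)//= lerDl sumr_ge0.
Qed.

End schwartz_lipschitz.

(** * Distance between a Gaussian average and a point value *)

Section gaussian_approximation.
Variables (R : realType) (N : nat).
Local Notation RT := (measurableTypeR R).
Local Notation lebN := (@lebesgue_tuple R N).

Lemma integrable_gauss_first_moment S (m : 'cV[R]_N) i : posdef S ->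
  lebN.-integrable setT (fun y => (gauss_density S m (vec y) * `|vec y i 0 - m i 0|)%:E).
Proof.
move=> Sp; apply/integrableP; split.
  apply/measurable_EFinP; apply: measurable_funM; first exact: measurable_gauss_density.
  by apply: measurableT_comp => //; apply: measurable_funB => //; exact: measurable_vec.
have p y : 0 <= gauss_density S m (vec y) * `|vec y i 0 - m i 0|.
  by rewrite mulr_ge0 ?gauss_density_ge0.
under eq_integral do rewrite /= (ger0_norm (p _)).
by apply: le_lt_trans (gauss_first_moment m i Sp (@ltr01 R)) _; rewrite ltry.
Qed.

(** The density has mass 1, so the difference is the average of f - f X. The Lipschitz bound and the
    triangle inequality through m separate the spread around m from the displacement m - X. *)
Lemma gauss_avg_approx S (m X : 'cV[R]_N) (f : 'cV[R]_N -> R) L h :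
  posdef S -> schwartz f -> 0 < h -> 0 <= L ->
  (forall X Y, `|f Y - f X| <= L * \sum_i `|Y i 0 - X i 0|) ->
  `|gauss_avg S m f - f X| <=
  L * \sum_i (2 * h * expR (S i i / h ^+ 2) + `|m i 0 - X i 0|).
Proof.
move=> Sp sf h0 L0 fL; have [C _ fC] := schwartz_bounded sf.
have cf := schwartz_continuous sf.
have gi := integrable_gauss_density m Sp.
have gfi := integrable_gauss_density_mul m Sp cf fC.
have g1 : \int[lebN]_y gauss_density S m (vec y) = 1.
  by rewrite /Rintegral integral_gauss_density.
have cfi : lebN.-integrable setT (EFin \o (fun y => f X * gauss_density S m (vec y))).
  exact: (integrableZl measurableT (f X) gi).
have -> : gauss_avg S m f - f X =
    \int[lebN]_y (gauss_density S m (vec y) * f (vec y) - f X * gauss_density S m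
      (vec y)).
  rewrite RintegralB// RintegralZl// g1 mulr1.
  done.
have di := integrableB measurableT gfi cfi.
apply: le_trans (le_normr_Rintegral measurableT di) _.
pose k i y := L * (gauss_density S m (vec y) * `|vec y i 0 - m i 0|) +
    (L * `|m i 0 - X i 0|) * gauss_density S m (vec y).
have k1i i : lebN.-integrable setT
    (EFin \o (fun y => L * (gauss_density S m (vec y) * `|vec y i 0 - m i 0|))).
  exact: (integrableZl measurableT L (integrable_gauss_first_moment m i Sp)).
have k2i i : lebN.-integrable setT
    (EFin \o (fun y => (L * `|m i 0 - X i 0|) * gauss_density S m (vec y))).
  exact: (integrableZl measurableT (L * `|m i 0 - X i 0|) gi).
have ki i : lebN.-integrable setT (EFin \o k i).
  exact: (integrableD measurableT (k1i i) (k2i i)).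
apply: (@le_trans _ _ (\int[lebN]_y \sum_i k i y)).
  apply: le_Rintegral => //.
  - exact: (integrable_norm di).
  - exact: integrable_sum_fin.
  - move=> y _; rewrite mulrC -mulrBl normrM (ger0_norm (gauss_density_ge0 _ _ _)).
    rewrite (_ : \sum_i k i y = (L * \sum_i (`|vec y i 0 - m i 0| + `|m i 0 - X i 0|)) *
        gauss_density S m (vec y)).
      rewrite ler_wpM2r ?gauss_density_ge0//; apply: le_trans (fL _ _) _.
      rewrite ler_wpM2l//; apply: ler_sum => i _.
      rewrite -[X in X <= _](_ : `|(vec y i 0 - m i 0) + (m i 0 - X i 0)| = _).
        exact: ler_normD.
      by rewrite addrA subrK.
    rewrite mulr_sumr mulr_suml; apply: eq_bigr => i _; rewrite /k; ring.
rewrite Rintegral_sum_fin// mulr_sumr; apply: ler_sum => i _.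
rewrite RintegralD// RintegralZl//; last exact: integrable_gauss_first_moment.
rewrite RintegralZl// g1 mulr1 mulrDr lerD2r ler_wpM2l//.
rewrite -lee_fin /Rintegral fineK; first exact: gauss_first_moment.
by apply: integrable_fin_num => //; exact: integrable_gauss_first_moment.
Qed.

Lemma gauss_avg_bounded S (m : 'cV[R]_N) (f : 'cV[R]_N -> R) C :
  posdef S -> continuous f -> (forall x, `|f x| <= C) -> `|gauss_avg S m f| <= C.
Proof.
move=> Sp cf fC; have gi := integrable_gauss_density m Sp.
have gfi := integrable_gauss_density_mul m Sp cf fC.
have g1 : \int[lebN]_y gauss_density S m (vec y) = 1.
  by rewrite /Rintegral integral_gauss_density.
apply: le_trans (le_normr_Rintegral measurableT gfi) _.
rewrite -[leRHS]mulr1 -g1 -RintegralZl//; apply: le_Rintegral => //.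
- exact: (integrable_norm gfi).
- exact: (integrableZl measurableT C gi).
- move=> y _; rewrite normrM (ger0_norm (gauss_density_ge0 _ _ _)) mulrC.
  by rewrite ler_wpM2r ?gauss_density_ge0.
Qed.

End gaussian_approximation.

(** * Short and long time behaviour of the semigroup *)

Section semigroup_asymptotics.
Variables (R : realType) (N : nat) (Q B : 'M[R]_N).
Hypotheses (N0 : (0 < N)%N) (Qsym : Q = Q^T) (Qpsd : psd Q).
Hypothesis Kinv : forall t : R, 0 < t -> Kmx Q B t \in unitmx.
Variables (f : 'cV[R]_N -> R) (X : 'cV[R]_N).
Hypothesis sf : schwartz f.
Local Notation M := (cov_integral Q B).
Local Notation P t := (Psg Q B t f X).
Let Mp (t : R) (t0 : 0 < t) := posdef_cov_integral Qsym Qpsd Kinv t0.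

Lemma Psg_gauss_avg (t : R) : 0 < t ->
  P t = gauss_avg (M t) (expmx (t *: B) *m X) f.
Proof.
move=> t0; have tn0 : t != 0 by rewrite gt_eqF.
rewrite /Psg /gauss_avg; congr integralRn; apply/funext => Y; congr (_ * _).
rewrite /kernel_p /gauss_density /gauss_const -(cov_integralE _ _ tn0).
congr (_ * expR (- _)).
rewrite [in RHS](cov_integralE _ _ tn0) [in RHS]invmxZ; last first.
  by rewrite unitmxZ; [exact: Kinv|rewrite unitfE].
by rewrite -scalemxAl innerZl; field.
Qed.

Lemma Psg_bounded : exists2 C, 0 <= C & forall t, 0 < t -> `|P t| <= C.
Proof.
have [C C0 fC] := schwartz_bounded sf; exists C => // t t0.
rewrite Psg_gauss_avg//; apply: gauss_avg_bounded => //; first exact: Mp.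
exact: schwartz_continuous.
Qed.

Lemma cvg_Psg_seq (u : nat -> R) S m : (\forall n \near \oo, 0 < u n) -> posdef S ->
  M (u n) @[n --> \oo] --> S -> expmx (u n *: B) *m X @[n --> \oo] --> m ->
  P (u n) @[n --> \oo] --> gauss_avg S m f.
Proof.
move=> [k _ uk] Sp MS em.
(* [cvg_gauss_avg] asks every matrix of the sequence to be positive definite; the first k terms,
   where u n may fail to be positive, are dropped. *)
rewrite -(cvg_shiftn k).
have upos n : 0 < u (n + k)%N by apply: uk => /=; exact: leq_addl.
have -> : (fun n => P (u (n + k)%N)) = (fun n =>
    gauss_avg (M (u (n + k)%N)) (expmx (u (n + k)%N *: B) *m X) f).
  by apply/funext => n; rewrite Psg_gauss_avg.
apply: cvg_gauss_avg => //.
- by move=> n; exact: Mp.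
- by rewrite (cvg_shiftn k (fun n => M (u n))).
- by rewrite (cvg_shiftn k (fun n => expmx (u n *: B) *m X)).
Qed.

(** Gives measurability in t of the Balakrishnan integrand. Limits are tested on sequences, the
    setting of dominated convergence. *)
Lemma continuous_Psg (t : R) : 0 < t -> P s @[s --> t] --> P t.
Proof.
move=> t0; apply: (iffRL (continuous_withinNx (fun s => P s) t)).
apply/cvgr_dnbhsP => u [_ ut]; rewrite Psg_gauss_avg//.
apply: cvg_Psg_seq; [| exact: Mp | |].
- by move/cvgrPdist_lt: ut => /(_ _ t0); apply: filterS => n; rewrite ltr_norml; lra.
- exact: (cvg_comp u _ ut (@cvg_cov_integral R N Q B t t0)).
- apply: cvg_mulmx; last exact: cvg_cst.
  exact: (cvg_comp u (fun s => expmx (s *: B)) ut (@cvg_expmx_at R N B t)).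
Qed.

Lemma cvg_Psg_unstable : 0 <= max_Re_spectrum B -> P t @[t --> +oo] --> 0.
Proof.
move=> sB; have [c c0 hc] := det_cov_integral_growth Qsym Qpsd Kinv N0 sB.
set I := integralRn (fun Y => `|f Y|).
have I0 : 0 <= I by apply: Rintegral_ge0.
set a := (4 * pi) `^ (- (N%:R / 2)) : R.
have a0 : 0 <= a by exact: powR_ge0.
have bnd t : 1 <= t -> `|P t| <= a * I / Num.sqrt (c * t).
  move=> t1; have t0 := lt_le_trans ltr01 t1; rewrite Psg_gauss_avg//.
  apply: le_trans (gauss_avg_le _ (Mp t0) sf) _.
  rewrite /gauss_const -/a -/I mulrAC ler_wpM2l ?mulr_ge0//.
  rewrite lef_pV2 ?posrE ?sqrtr_gt0 ?mulr_gt0//; last exact: posdef_det_gt0 (Mp t0).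
  by rewrite ler_wsqrtr// hc.
apply/cvgr0Pnorm_lt => e e0.
near=> t.
have t1 : 1 <= t by near: t; exact: nbhs_pinfty_ge.
have t0 := lt_le_trans ltr01 t1.
apply: le_lt_trans (bnd _ t1) _.
rewrite ltr_pdivrMr ?sqrtr_gt0 ?mulr_gt0// [ltRHS]mulrC -ltr_pdivrMr//.
have h : 0 <= a * I / e by rewrite divr_ge0 ?mulr_ge0// ltW.
rewrite -(ger0_norm h) -sqrtr_sqr ltr_sqrt ?mulr_gt0// [ltRHS]mulrC -ltr_pdivrMr//.
by near: t; apply: nbhs_pinfty_gt; exact: num_real.
Unshelve. all: by end_near. Qed.

Lemma cvg_Psg_stable : max_Re_spectrum B < 0 ->
  P t @[t --> +oo] --> gauss_avg (Kinfty Q B) 0 f.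
Proof.
move=> sB; apply/cvg_pinftyP => u uoo.
apply: cvg_Psg_seq; [| exact: posdef_Kinfty | |].
- by move/cvgryPgt : uoo; exact.
- exact: cvg_cov_integraly.
- rewrite (_ : (0 : 'cV[R]_N) = (0 : 'M[R]_N) *m X); last by rewrite mul0mx.
  apply: cvg_mulmx; last exact: cvg_cst.
  exact: cvg_expmxy.
Qed.

(** Mean value theorem: the derivative B e^{sB} X is bounded on [0, 1] by compactness. *)
Lemma expmx_mul_sub_le : exists2 C, 0 <= C & forall (t : R) i, 0 <= t <= 1 ->
  `|(expmx (t *: B) *m X) i 0 - X i 0| <= C * t.
Proof.
have D i (t : R) : is_derive t 1 (fun s => (expmx (s *: B) *m X) i 0)
    ((B *m expmx (t *: B) *m X) i 0).
  have Di j : is_derive t 1 (fun s => expmx (s *: B) i j * X j 0)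
      ((B *m expmx (t *: B)) i j * X j 0).
    have h := is_derive_expmxl 1%:M B t i j; rewrite mul1mx in h.
    rewrite (_ : (fun s => _) = (fun s => X j 0 * (1%:M *m expmx (s *: B)) i j)).
      by apply: (is_derive_eq (is_deriveZ (X j 0) h)); exact: mulrC.
    by apply/funext => s; rewrite mul1mx mulrC.
  have h := is_derive_sum Di; rewrite [_ i 0]mxE.
  rewrite (_ : (fun s => _) = \sum_(j < N) (fun s => expmx (s *: B) i j * X j 0))//.
  by apply/funext => s; rewrite fct_sumE mxE.
have cD i : continuous (fun t : R => `|(B *m expmx (t *: B) *m X) i 0|).
  move=> t; apply: cvg_norm; apply: cvg_coord; apply: cvg_mulmx; last exact: cvg_cst.
  by apply: cvg_mulmx; [exact: cvg_cst|exact: cvg_expmx_at].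
have /choice[C HC] : forall i, exists C, forall s, s \in `[0, 1] ->
    `|(B *m expmx (s *: B) *m X) i 0| <= C.
  move=> i; have [c _ hc] := @EVT_max R _ 0 1 ler01 (continuous_subspaceT (cD i)).
  by exists `|(B *m expmx (c *: B) *m X) i 0|.
have C0 i : 0 <= C i.
  by apply: le_trans (HC i 0 _); rewrite ?in_itv/= ?lexx ?ler01.
exists (\sum_i C i); first exact: sumr_ge0.
move=> t i /andP[t0 t1].
have [c cI] := @MVT_segment R _ _ 0 t t0 (fun x _ => D i x)
  (derivable_within_continuous (fun x _ => @ex_derive _ _ _ _ _ _ _ (D i x))).
rewrite expmx0 mul1mx subr0 => ->; rewrite normrM (ger0_norm t0) ler_wpM2r//.
apply: (@le_trans _ _ (C i)).
  apply: HC; move: cI; rewrite !in_itv/= => /andP[-> ct].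
  exact: le_trans ct t1.
by rewrite (bigD1 i)//= lerDl sumr_ge0.
Qed.

Lemma Psg_small_time : exists2 C, 0 <= C & forall t, 0 < t <= 1 ->
  `|P t - f X| <= C * Num.sqrt t.
Proof.
have [L L0 fL] := schwartz_lipschitz sf.
have [C1 C10 hC1] := cov_integral_diag_le Q B.
have [C2 C20 hC2] := expmx_mul_sub_le.
exists (L * (N%:R * (2 * expR C1 + C2))).
  by rewrite !mulr_ge0// addr_ge0// mulr_ge0// expR_ge0.
move=> t /andP[t0 t1]; rewrite Psg_gauss_avg//.
have st0 : 0 < Num.sqrt t by rewrite sqrtr_gt0.
(* At the scale h = sqrt t the exponent M_ii / h^2 is at most C1, so the spread costs O(sqrt t); the
   drift costs C2 t <= C2 sqrt t because t <= 1. *)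
apply: le_trans (gauss_avg_approx _ X (Mp t0) sf st0 L0 fL) _.
have -> : L * (N%:R * (2 * expR C1 + C2)) * Num.sqrt t =
    L * \sum_(i < N) (2 * expR C1 + C2) * Num.sqrt t.
  by rewrite sumr_const card_ord -[_ *+ N]mulr_natl; ring.
rewrite ler_wpM2l//.
apply: ler_sum => i _; rewrite [leRHS]mulrDl; apply: lerD.
  rewrite mulrAC ler_wpM2r ?(ltW st0)// ler_wpM2l// ler_expR sqr_sqrtr ?(ltW t0)//.
  by rewrite ler_pdivrMr// hC1// (ltW t0).
apply: le_trans (hC2 t i _) _; first by rewrite (ltW t0).
rewrite ler_wpM2l// -{1}(sqr_sqrtr (ltW t0)) expr2 ler_piMr ?(ltW st0)//.
by rewrite -[leRHS]sqrtr1 ler_wsqrtr.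
Qed.

End semigroup_asymptotics.

(** * The limit s -> 0 in the Balakrishnan formula *)

Section power_integrals.
Variable R : realType.
Local Notation mu := (@lebesgue_measure R).
Implicit Types (p s t : R).

Lemma continuous_powR p t : 0 < t -> {for t, continuous (fun x : R => x `^ p)}.
Proof.
move=> t0; apply: differentiable_continuous; apply/derivable1_diffP.
by have [] := is_derive1_powR p t0.
Qed.

Lemma continuousZ_powR c p t : 0 < t -> {for t, continuous (fun x : R => c * x `^ p)}.
Proof.
move=> t0; apply: differentiable_continuous; apply/derivable1_diffP.
by have [] := is_deriveZ c (is_derive1_powR p t0).
Qed.

Lemma measurable_powR_inv p : measurable_fun setT (fun t : R => (t `^ p)^-1).
Proof.
rewrite (_ : (fun _ => _) = (fun t : R => t `^ (- p))); first exact: measurable_powR.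
by apply/funext => t; rewrite powRN.
Qed.

Lemma integral_powR_itv p (a : R) : 0 < p -> 0 < a < 1 ->
  (\int[mu]_(t in `[a, 1%R]) (p * t `^ (p - 1))%:E = (1 - a `^ p)%:E)%E.
Proof.
move=> p0 /andP[a0 a1].
have pos (t : R) : a <= t -> 0 < t by exact: lt_le_trans.
rewrite (@continuous_FTC2 _ _ (fun t => t `^ p))// ?powR1//.
- apply: continuous_in_subspaceT => t; rewrite inE/= in_itv/= => /andP[/pos t0 _].
  exact: continuousZ_powR.
- split.
  + by move=> t; rewrite in_itv/= => /andP[/ltW/pos t0 _];
    have [] := is_derive1_powR p t0.
  + by apply: cvg_at_right_filter; apply: continuous_powR.
  + by apply: cvg_at_left_filter; apply: continuous_powR.
- by move=> t; rewrite in_itv/= => /andP[/ltW/pos t0 _];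
    rewrite powR_derive1// in_itv/= andbT.
Qed.

Lemma integrable_powR01 p : 0 < p ->
  mu.-integrable `]0, 1] (EFin \o (fun t => t `^ (p - 1))).
Proof.
move=> p0.
have mp : measurable_fun setT (fun t : R => p * t `^ (p - 1)).
  by apply: measurable_funM => //; exact: measurable_powR.
have h : mu.-integrable `]0, 1] (EFin \o (fun t => p * t `^ (p - 1))).
  apply/integrableP; split; first by apply/measurable_EFinP; exact: measurable_funTS.
  under eq_integral do rewrite /= ger0_norm ?mulr_ge0 ?powR_ge0 ?(ltW p0)//.
  (* The denominator k + 2 keeps the left end strictly below 1, as [integral_powR_itv] requires. The
     integrals over these sets increase to the one over ]0, 1] and never exceed 1. *)
  pose F (k : nat) : set (measurableTypeR R) := `[k.+2%:R^-1, 1]%classic.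
  have -> : `]0, 1]%classic = \bigcup_k F k.
    apply/seteqP; split=> t /=; rewrite in_itv/=.
      move=> /andP[t0 t1]; exists (Num.truncn t^-1) => //.
      rewrite /F/= in_itv/= t1 andbT invf_ple ?posrE// ltW//.
      apply: lt_le_trans (truncnS_gt _) _.
      by rewrite ler_nat.
    move=> [k _]; rewrite /F/= in_itv/= => /andP[kt ->]; rewrite andbT.
    by apply: lt_le_trans kt; rewrite invr_gt0.
  have nF : nondecreasing_seq F.
    move=> k l kl; apply/subsetPset => t; rewrite /F/= !in_itv/= => /andP[kt ->].
    by rewrite andbT (le_trans _ kt)// lef_pV2 ?posrE// ler_nat ltnS ltnS.
  have cv := @ge0_nondecreasing_set_cvg_integral _ _ R F
    (fun t => (p * t `^ (p - 1))%:E) mu nF.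
  apply: (@le_lt_trans _ _ 1%E); last by rewrite ltry.
  apply: (cvge_to_le (cv _ _ _)) => [k|k|k t _|].
  - exact: measurable_itv.
  - by apply/measurable_EFinP; exact: measurable_funTS.
  - by rewrite lee_fin mulr_ge0 ?powR_ge0 ?ltW.
  - apply: nearW => k; rewrite integral_powR_itv//.
      by rewrite lee_fin gerBl powR_ge0.
    by rewrite invr_gt0 ltr0n invf_lt1// ltr1n.
have mD : measurable (`]0, 1]%classic : set (measurableTypeR R)).
  exact: measurable_itv.
have := integrableZl mD p^-1 h; apply: eq_integrable => // t _ /=.
by rewrite -EFinM mulKf// gt_eqF.
Qed.

Lemma cvg_powRN_pinfty s : 0 < s -> t `^ (- s) @[t --> +oo] --> (0 : R).
Proof.
move=> s0; apply/cvgr0Pnorm_lt => e e0; near=> t.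
have t0 : (e^-1) `^ s^-1 < t by near: t; apply: nbhs_pinfty_gt; exact: num_real.
have tp : 0 < t by apply: le_lt_trans t0; exact: powR_ge0.
rewrite ger0_norm ?powR_ge0// powRN invf_plt ?posrE ?powR_gt0//.
rewrite -[ltLHS](@powRr1 _ e^-1) ?invr_ge0 ?(ltW e0)// -(mulVf (lt0r_neq0 s0)) powRrM.
by rewrite gt0_ltr_powR// ?nnegrE ?powR_ge0// ltW.
Unshelve. all: by end_near. Qed.

Lemma integral_powR1y s : 0 < s ->
  (\int[mu]_(t in `[1%R, +oo[) (s * t `^ (- (1 + s)))%:E = 1)%E.
Proof.
move=> s0.
have pos (t : R) : 1 <= t -> 0 < t by exact: lt_le_trans.
have D (t : R) : 0 < t ->
    is_derive t 1 (fun t : R => - t `^ (- s)) (s * t `^ (- (1 + s))).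
  move=> t0; apply: (is_derive_eq (is_deriveN (is_derive1_powR (- s) t0))).
  by rewrite opprD addrC mulNr opprK.
rewrite (@ge0_continuous_FTC2y _ _ (fun t => - t `^ (- s)) _ 0).
- by rewrite powR1 sub0e -EFinN opprK.
- by move=> t t1; rewrite mulr_ge0 ?(ltW s0)// powR_ge0.
- apply: continuous_in_subspaceT => t; rewrite inE/= in_itv/= andbT => /pos t0.
  exact: continuousZ_powR.
- by rewrite -oppr0; apply: cvgN; exact: cvg_powRN_pinfty.
- by move=> t /ltW/pos t0; have [] := D t t0.
- apply: cvg_at_right_filter; apply: cvgN; apply: continuous_powR; exact: ltr01.
- by move=> t; rewrite in_itv/= andbT => /ltW/pos t0; rewrite derive1E;
    have [_ ->] := D t t0.
Qed.

Lemma integrable_powR1y s : 0 < s ->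
  mu.-integrable `]1, +oo[ (EFin \o (fun t => s * (t `^ (1 + s))^-1)) /\
  \int[mu]_(t in `]1, +oo[) (s * (t `^ (1 + s))^-1) = 1.
Proof.
move=> s0.
have p t : 0 <= s * (t `^ (1 + s))^-1.
  by rewrite mulr_ge0 ?(ltW s0)// invr_ge0 powR_ge0.
have m : measurable_fun setT (fun t : R => s * (t `^ (1 + s))^-1).
  by apply: measurable_funM => //; exact: measurable_powR_inv.
have I : (\int[mu]_(t in `]1%R, +oo[) (s * (t `^ (1 + s))^-1)%:E = 1)%E.
  rewrite -(integral_powR1y s0) -integral_itv_obnd_cbnd//.
  by under [RHS]eq_integral do rewrite powRN.
  by apply/measurable_EFinP; apply: measurable_funTS; apply: measurable_funM.
split; last by rewrite /Rintegral I.
apply/integrableP; split; first by apply/measurable_EFinP; exact: measurable_funTS.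
under eq_integral do rewrite /= (ger0_norm (p _)).
by rewrite I ltry.
Qed.

End power_integrals.

(** * The limit of Gamma(1 - s) and the Abelian theorem for the weight s t^(-1-s) *)

Section abelian.
Variable R : realType.
Local Notation mu := (@lebesgue_measure R).
Local Notation RT := (measurableTypeR R).
Let mD0 : measurable (`]0, 1]%classic : set RT). Proof. exact: measurable_itv. Qed.
Let mD1 : measurable (`]1, +oo[%classic : set RT). Proof. exact: measurable_itv. Qed.
Let mD : measurable (`]0, +oo[%classic : set RT). Proof. exact: measurable_itv. Qed.

Lemma itv0y_split : `]0, +oo[%classic = `]0, 1] `|` `]1, +oo[ :> set RT.
Proof.
apply/seteqP; split=> t /=; rewrite !in_itv/= !andbT.
  by move=> t0; have [t1|t1] := leP t 1; [left; rewrite t0|right].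
by case=> [/andP[]//|]; apply: lt_trans.
Qed.

Lemma itv0y_disj : [disjoint (`]0, 1]%classic : set RT) & `]1, +oo[%classic].
Proof.
rewrite disj_set2E; apply/eqP/seteqP; split=> // t /=.
by rewrite !in_itv/= andbT => -[/andP[_ t1]]; rewrite ltNge t1.
Qed.

Lemma integrable_itv0y (g : R -> R) :
  mu.-integrable `]0, 1] (EFin \o g) -> mu.-integrable `]1, +oo[ (EFin \o g) ->
  mu.-integrable `]0, +oo[ (EFin \o g).
Proof.
move=> /integrableP[mg0 g0] /integrableP[mg1 g1]; rewrite itv0y_split.
apply/integrableP; split; first by apply: (iffRL (measurable_funU _ mD0 mD1)).
rewrite ge0_integral_setU//=; last 2 first.
- apply: measurableT_comp => //; apply: measurableT_comp => //.
  by apply: (iffRL (measurable_funU _ mD0 mD1)); split; exact/measurable_EFinP.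
- exact: itv0y_disj.
exact: lte_add_pinfty.
Qed.

Lemma integral_expRN : \int[mu]_(t in `]0, +oo[) expR (- t) = 1 :> R.
Proof.
have h : \int[mu]_t exponential_pdf (1 : R) t = 1.
  by rewrite /Rintegral integral_exponential_pdf.
rewrite -[RHS]h /exponential_pdf -Rintegral_mkcond.
rewrite /Rintegral integral_itv_obnd_cbnd; last first.
  by apply/measurable_EFinP; apply: measurable_funTS; apply: measurableT_comp.
by congr fine; apply: eq_integral => t _; rewrite mul1r mulN1r.
Qed.

(* The integrand t^-s e^-t is dominated by t^(-3/4) on ]0,1] and by e^-t on ]1,oo[. *)
Lemma cvg_Gamma1 : Gamma (1 - s) @[s --> (0 : R)^'+] --> (1 : R).
Proof.
apply/cvg_at_rightP => u [u0 uc].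
have [k _ uk] : \forall n \near \oo, u n <= 3 / 4.
  have h34 : 0 < 3 / 4 :> R by rewrite divr_gt0.
  move/cvgrPdist_le : uc => /(_ _ h34); apply: filterS => n.
  by rewrite sub0r normrN ger0_norm// ltW.
rewrite -(cvg_shiftn k).
suff : Gamma (1 - u (n + k)%N) @[n --> \oo] --> \int[mu]_(t in `]0, +oo[) expR (- t).
  by rewrite integral_expRN.
pose d (t : R) := if t <= 1 then t `^ (4^-1 - 1) else expR (- t).
have me : measurable_fun setT (fun t : R => expR (- t)) by exact: measurableT_comp.
have ei : mu.-integrable `]1, +oo[ (EFin \o (fun t => expR (- t))).
  have mD' : measurable (`[0, +oo[%classic : set RT) by exact: measurable_itv.
  have sD : (`]1, +oo[%classic : set RT) `<=` `[0, +oo[.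
    by apply: subset_itvr; rewrite bnd_simp.
  have := integrableS mD' mD1 sD (integrable_expR_decay (@ltr01 R)).
  by apply: eq_integrable => // t _ /=; rewrite mulN1r.
have di : mu.-integrable `]0, +oo[ (EFin \o d).
  apply: integrable_itv0y.
    have : mu.-integrable `]0, 1] (EFin \o (fun t => t `^ (4^-1 - 1))).
      exact: integrable_powR01.
    by apply: eq_integrable => // t; rewrite inE/= in_itv/= /d => /andP[_ ->].
  apply: eq_integrable ei => // t; rewrite inE/= in_itv/= andbT /d => t1.
  by rewrite leNgt t1.
apply: (@cvg_Rintegral_dominated _ _ R mu _ _ _ d mD _ _ di).
- by move=> n; apply: measurable_funTS; apply: measurable_funM.
- move=> t /=; rewrite in_itv/= andbT => t0.
  have h : t `^ (1 - u (n + k)%N - 1) @[n --> \oo] --> (1 : R).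
    have c : - u (n + k)%N * ln t @[n --> \oo] --> - 0 * ln t.
      apply: cvgM; last exact: cvg_cst.
      by apply: cvgN; rewrite (cvg_shiftn k u).
    have := cvg_comp (fun n => - u (n + k)%N * ln t) (@expR R) c (@continuous_expR R _).
    rewrite oppr0 mul0r expR0; apply: cvg_trans; apply: near_eq_cvg; near=> n.
    by rewrite /powR gt_eqF// addrAC subrr add0r.
  have c2 : (fun=> expR (- t)) n @[n --> \oo] --> expR (- t) by exact: cvg_cst.
  by have /(_ _) := cvgM h c2; rewrite mul1r; apply.
- move=> n t /=; rewrite in_itv/= andbT => t0.
  have un : u (n + k)%N <= 3 / 4 by apply: uk => /=; exact: leq_addl.
  have un0 := u0 (n + k)%N.
  rewrite ger0_norm ?mulr_ge0 ?powR_ge0 ?expR_ge0// /d; case: (leP t 1) => t1.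
    apply: (@le_trans _ _ (t `^ (1 - u (n + k)%N - 1))).
      rewrite ler_piMr ?powR_ge0// -[leRHS]expR0 ler_expR oppr_le0; exact: ltW.
    by rewrite ger_powR ?t0//; lra.
  rewrite ler_piMl ?expR_ge0// -[leRHS](powRr0 t); apply: ler_powR; first exact: ltW.
  by lra.
Unshelve. all: by end_near. Qed.

(* The part over ]0,T] is O(s); on ]T,oo[, where g is close to l, the weight
   s t^(-1-s) has mass T^(-s), which tends to 1. *)
Lemma abelian_limit (g : R -> R) (l C K : R) :
  measurable_fun (`]0, +oo[%classic : set RT) g ->
  0 <= C -> (forall t, 0 < t <= 1 -> `|g t| <= C * Num.sqrt t) ->
  0 <= K -> (forall t, 0 < t -> `|g t| <= K) ->
  g t @[t --> +oo] --> l ->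
  s * \int[mu]_(t in `]0, +oo[) ((t `^ (1 + s))^-1 * g t) @[s --> 0^'+] --> l.
Proof.
move=> mg C0 gC K0 gK gl.
pose h s t : R := (t `^ (1 + s))^-1.
have h0 s t : 0 <= h s t by rewrite invr_ge0 powR_ge0.
pose k34 (t : R) := t `^ (4^-1 - 1).
have k34i : mu.-integrable `]0, 1] (EFin \o k34) by apply: integrable_powR01.
pose I34 := \int[mu]_(t in `]0, 1]) k34 t.
have I340 : 0 <= I34 by apply: Rintegral_ge0 => t _; exact: powR_ge0.
have mhg s (D : set RT) : measurable D -> D `<=` `]0, +oo[ ->
    measurable_fun D (fun t => h s t * g t).
  move=> mD' DD; apply: measurable_funM; last exact: measurable_funS mg.
  by apply: measurable_funTS; exact: measurable_powR_inv.
have sub0 : (`]0, 1]%classic : set RT) `<=` `]0, +oo[.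
  by apply: subset_itvl; rewrite bnd_simp.
have sub1 : (`]1, +oo[%classic : set RT) `<=` `]0, +oo[.
  by apply: subset_itvr; rewrite bnd_simp.
(* The exponent is -1 - s + 1/2, which is at least -3/4 when s <= 1/4. *)
have hg0 s t : 0 < s <= 4^-1 -> 0 < t <= 1 -> `|h s t * g t| <= C * k34 t.
  move=> /andP[s0 s4] /[dup] t01 /andP[t0 t1].
  rewrite normrM (ger0_norm (h0 _ _)).
  apply: le_trans (ler_wpM2l (h0 _ _) (gC t t01)) _.
  rewrite mulrCA ler_wpM2l// -powR12_sqrt ?(ltW t0)// /h -powRN -powRD; last first.
    by apply/implyP => _; rewrite gt_eqF.
  by rewrite /k34 ger_powR// ?t0//; lra.
have hg0i s : 0 < s <= 4^-1 -> mu.-integrable `]0, 1] (EFin \o (fun t => h s t * g t)).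
  move=> hs; apply: (le_integrable mD0 _ _ (integrableZl mD0 C k34i)).
    by apply/measurable_EFinP; exact: mhg.
  move=> t /=; rewrite in_itv/= => t01.
  rewrite lee_fin [leRHS]ger0_norm ?mulr_ge0 ?powR_ge0//; exact: hg0.
have hg0b s : 0 < s <= 4^-1 -> `|\int[mu]_(t in `]0, 1]) (h s t * g t)| <= C * I34.
  move=> hs; apply: le_trans (le_normr_Rintegral mD0 (hg0i s hs)) _.
  rewrite -RintegralZl//; apply: le_Rintegral => //.
  - exact: integrable_norm (hg0i s hs).
  - exact: (integrableZl mD0 C k34i).
  - by move=> t /=; rewrite in_itv/= => t01; exact: hg0.
have hi s : 0 < s -> mu.-integrable `]1, +oo[ (EFin \o h s).
  move=> s0; have [hi _] := integrable_powR1y s0.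
  have := integrableZl mD1 s^-1 hi; apply: eq_integrable => // t _ /=.
  by rewrite -EFinM mulKf// gt_eqF.
have hI s : 0 < s -> s * \int[mu]_(t in `]1, +oo[) h s t = 1.
  by move=> s0; rewrite -RintegralZl ?hi//; have [_ ->] := integrable_powR1y s0.
have hgi s : 0 < s -> mu.-integrable `]1, +oo[ (EFin \o (fun t => h s t * g t)).
  move=> s0; apply: (le_integrable mD1 _ _ (integrableZl mD1 K (hi s s0))).
    by apply/measurable_EFinP; exact: mhg.
  move=> t /=; rewrite in_itv/= andbT => t1.
  rewrite lee_fin [leRHS]ger0_norm ?mulr_ge0// normrM (ger0_norm (h0 _ _)) mulrC.
  by rewrite ler_wpM2r// gK// (lt_trans ltr01).
apply/cvgrPdist_le => e e0.
have e20 : 0 < e / 2 by rewrite divr_gt0.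
have [T [_ hT]] : \forall t \near +oo, `|l - g t| <= e / 2.
  by move/cvgrPdist_le : gl; exact.
pose T1 := Num.max 1 T.
have T10 : 0 < T1 by rewrite lt_max ltr01.
(* On ]1, T1] the difference |g - l| is at most K + |l|, and t^(-1-s) <= 1/t <= T1 / t^2. The
   majorant A t^(-2) is independent of s, so the factor s makes its contribution vanish. *)
pose A := (K + `|l|) * T1.
have A0 : 0 <= A by rewrite mulr_ge0 ?addr_ge0// ltW.
have gl1 s t : 0 < s -> 1 < t -> `|h s t * (g t - l)| <= A * h 1 t + e / 2 * h s t.
  move=> s0 t1; have t0 := lt_trans ltr01 t1.
  rewrite normrM (ger0_norm (h0 _ _)).
  have [tT|Tt] := leP t T1.
    apply: (@le_trans _ _ (A * h 1 t)); last by rewrite lerDl mulr_ge0// ltW.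
    rewrite /A -mulrA mulrC; apply: ler_pM => //.
      by apply: le_trans (ler_normB _ _) _; rewrite lerD2r gK.
    rewrite /h (_ : (1 + 1 : R) = 2%:R)// powR_mulrn ?(ltW t0)//.
    apply: (@le_trans _ _ t^-1).
      rewrite lef_pV2 ?posrE ?powR_gt0// -[leLHS]powRr1 ?(ltW t0)//.
      by apply: ler_powR; [exact: ltW|lra].
    by rewrite expr2 invfM mulrA ler_peMl ?invr_ge0 ?(ltW t0)// ler_pdivlMr// mul1r.
  apply: (@le_trans _ _ (e / 2 * h s t)); last by rewrite lerDr mulr_ge0.
  rewrite mulrC ler_wpM2r// distrC; apply: hT.
  by apply: le_lt_trans Tt; rewrite le_max lexx orbT.
have gli s : 0 < s -> mu.-integrable `]1, +oo[ (EFin \o (fun t => h s t * (g t - l))).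
  move=> s0; have := integrableB mD1 (hgi s s0) (integrableZl mD1 l (hi s s0)).
  by apply: eq_integrable => // t _ /=; congr EFin; ring.
(* The weight s t^(-1-s) has mass 1 on ]1, oo[, so l can be subtracted under that integral. *)
have split_int s : 0 < s <= 4^-1 -> s * \int[mu]_(t in `]0, +oo[) (h s t * g t) - l =
    s * \int[mu]_(t in `]0, 1]) (h s t * g t) +
    s * \int[mu]_(t in `]1, +oo[) (h s t * (g t - l)).
  move=> /[dup] hs /andP[s0 _].
  rewrite itv0y_split Rintegral_setU//; last 2 first.
  - by rewrite -itv0y_split; apply: integrable_itv0y; [exact: hg0i|exact: hgi].
  - exact: itv0y_disj.
  have -> : \int[mu]_(t in `]1, +oo[) (h s t * (g t - l)) =
    \int[mu]_(t in `]1, +oo[) (h s t * g t) - l * \int[mu]_(t in `]1, +oo[) h s t.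
    rewrite -RintegralZl ?hi// -RintegralB//;
      [|exact: hgi|exact: (integrableZl mD1 l (hi s s0))].
    by apply: eq_Rintegral => t _; ring.
  by rewrite mulrDr mulrBr [s * (l * _)]mulrCA hI// mulr1 addrA.
have bound s : 0 < s <= 4^-1 ->
    `|l - s * \int[mu]_(t in `]0, +oo[) (h s t * g t)| <= s * (C * I34 + A) + e / 2.
  move=> /[dup] hs /andP[s0 _]; rewrite distrC split_int//.
  apply: le_trans (ler_normD _ _) _.
  rewrite !normrM (gtr0_norm s0) mulrDr -addrA; apply: lerD.
    by rewrite ler_wpM2l ?(ltW s0)// hg0b.
  have Ai : mu.-integrable `]1, +oo[ (EFin \o (fun t => A * h 1 t)).
    exact: (integrableZl mD1 A (hi 1 ltr01)).
  have ei : mu.-integrable `]1, +oo[ (EFin \o (fun t => e / 2 * h s t)).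
    exact: (integrableZl mD1 (e / 2) (hi s s0)).
  apply: (@le_trans _ _ (s * \int[mu]_(t in `]1, +oo[) (A * h 1 t + e / 2 * h s t))).
    rewrite ler_wpM2l ?(ltW s0)//.
    apply: le_trans (le_normr_Rintegral mD1 (gli s s0)) _.
    apply: le_Rintegral => //.
    - exact: integrable_norm (gli s s0).
    - exact: (integrableD mD1 Ai ei).
    - by move=> t /=; rewrite in_itv/= andbT => t1; exact: gl1.
  rewrite RintegralD// !RintegralZl ?hi// mulrDr [s * (e / 2 * _)]mulrCA hI// mulr1.
  by have := hI 1 ltr01; rewrite mul1r => ->; rewrite mulr1.
have D0 : 0 < C * I34 + A + 1 by rewrite ltr_wpDl// addr_ge0// mulr_ge0.
near=> s.
have s0 : 0 < s by [].
have s4 : s <= 4^-1 by near: s; apply: nbhs_right_le.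
apply: le_trans (bound s _) _; first by rewrite s0.
rewrite [leRHS]splitr lerD2r.
apply: (@le_trans _ _ (s * (C * I34 + A + 1))).
  by rewrite ler_wpM2l ?(ltW s0)// lerDl.
rewrite -ler_pdivlMr//; near: s; apply: nbhs_right_le.
by rewrite divr_gt0.
Unshelve. all: by end_near. Qed.

End abelian.

(** The prefactor is split: s goes to the Abelian limit, whose value is l - f X, and -1 / Gamma(1 -
    s) tends to -1. *)
Lemma cvg_fracpow (R : realType) (N : nat) (N0 : (0 < N)%N) (Q B : 'M[R]_N)
    (Qsym : Q = Q^T) (Qpsd : psd Q)
    (Kinv : forall t : R, 0 < t -> Kmx Q B t \in unitmx)
    (f : 'cV[R]_N -> R) (sf : schwartz f) (X : 'cV[R]_N) (l : R) :
  Psg Q B t f X @[t --> +oo] --> l ->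
  fracpow Q B s f X @[s --> 0^'+] --> f X - l.
Proof.
move=> Pl.
have [C C0 hC] := Psg_small_time Qsym Qpsd Kinv X sf.
have [K K0 hK] := Psg_bounded Qsym Qpsd Kinv X sf.
pose g t := Psg Q B t f X - f X.
have gl : g t @[t --> +oo] --> l - f X by apply: cvgB => //; exact: cvg_cst.
have mg : measurable_fun (`]0, +oo[%classic : set (measurableTypeR R)) g.
  apply: open_continuous_measurable_fun; first exact: interval_open.
  move=> t; rewrite inE/= in_itv/= andbT => t0.
  by apply: cvgB; [exact: continuous_Psg|exact: cvg_cst].
have gK t : 0 < t -> `|g t| <= K + `|f X|.
  by move=> t0; apply: le_trans (ler_normB _ _) _; rewrite lerD2r hK.
have := abelian_limit mg C0 hC (addr_ge0 K0 (normr_ge0 (f X))) gK gl.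
move=> h; have G := @cvg_Gamma1 R.
have : - (Gamma (1 - s))^-1 * (s * \int[@lebesgue_measure R]_(t in `]0, +oo[)
    ((t `^ (1 + s))^-1 * g t)) @[s --> 0^'+] --> - 1^-1 * (l - f X).
  apply: cvgM => //; apply: cvgN; apply: cvgV => //; exact: oner_neq0.
rewrite invr1 mulN1r opprB; apply: cvg_trans; apply: near_eq_cvg; near=> s.
by rewrite /fracpow/= /g; ring.
Unshelve. all: by end_near. Qed.

Theorem proposition2p5 (R : realType) (N : nat) (N_ge1 : (1 <= N)%N)
    (Q B : 'M[R]_N) (Qsym : Q = Q^T) (Qpsd : psd Q)
    (Kinv : forall t : R, 0 < t -> Kmx Q B t \in unitmx)
    (f : 'cV[R]_N -> R) (fS : schwartz f) (X : 'cV[R]_N) :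
  (0 <= max_Re_spectrum B ->
     fracpow Q B s f X @[s --> 0^'+] --> f X) /\
  (max_Re_spectrum B < 0 ->
     fracpow Q B s f X @[s --> 0^'+] -->
       f X - (4 * pi) `^ (- (N%:R / 2)) / Num.sqrt (\det (Kinfty Q B)) *
         integralRn (fun Y =>
           f Y * expR (- (inner (invmx (Kinfty Q B) *m Y) Y / 4)))).
Proof.
split=> sB.
  rewrite -[X in _ --> X]subr0; apply: cvg_fracpow => //.
  exact: cvg_Psg_unstable.
apply: cvg_fracpow => //.
have Kp := posdef_Kinfty N_ge1 sB Qsym Qpsd Kinv.
rewrite (_ : _ * integralRn _ = gauss_avg (Kinfty Q B) 0 f).
  exact: cvg_Psg_stable.
(* Moving the normalising constant under the integral requires integrability. The exponential is at
   most 1, so |f| dominates. *)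
have fe : (@lebesgue_tuple R N).-integrable setT
    (EFin \o (fun y => f (vec y) *
      expR (- (inner (invmx (Kinfty Q B) *m vec y) (vec y) / 4)))).
  apply: (le_integrable measurableT _ _ (schwartz_integrable fS)).
    apply/measurable_EFinP; apply: measurable_funM.
      by apply: measurable_vec_continuous; exact: schwartz_continuous.
    apply: measurableT_comp => //; apply: measurableT_comp => //.
    apply: measurable_funM => //.
    have := @measurable_inner_vec R N (invmx (Kinfty Q B)) 0 0.
    by under eq_fun do rewrite subr0.
  move=> y _ /=; rewrite lee_fin normrM (ger0_norm (expR_ge0 _)) ler_piMr//.
  rewrite -[leRHS]expR0 ler_expR oppr_le0 divr_ge0//.
  exact/posdef_ge0/posdef_invmx.
rewrite /integralRn -RintegralZl//; apply: eq_Rintegral => y _.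
by rewrite /gauss_density /gauss_const subr0; ring.
Qed.
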